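(* There exist an untwisted flute $F$ and a vector $u\in\Omega_h\subset T^1F$, corresponding to an infinite quasi-minimizing geodesic ray $u(\mathbb R^+)$, such that: \begin{enumerate} \item the horocyclic orbit $h_{\mathbb R}u$ is neither closed nor dense in $\Omega_h$; \item $\mathrm{Inj}(u(\mathbb R^+))=+\infty$; \item $T_u=\{t\in\mathbb R \;:\; g_tu\in\overline{h_{\mathbb R}u}\}=\{0\}$. \end{enumerate}
   Context: $\mathbb H$ is the Poincaré half-plane with its hyperbolic metric $d$. A hyperbolic surface is a quotient $S=\Gamma\backslash\mathbb H$ with $\Gamma$ a Fuchsian group without elliptic elements; $T^1S$ is its unit tangent bundle. $(g_t)$ and $(h_s)$ denote the geodesic and horocyclic flows on $T^1S$, and $h_{\mathbb R}u=\{h_su: s\in\mathbb R\}$; horocycles are centered at the forward endpoint $\widetilde u(\infty)$ of lifts $\widetilde u$ of $u$. $u(\mathbb R^+)$, with parametrization $(u(t))_{t\ge0}$, is the geodesic ray on $S$ defined by $u$. $\Omega_h$ is the non-wandering set of the horocyclic flow: $u\in\Omega_h$ iff $\widetilde u(\infty)$ lies in the limit set of $\Gamma$. Flutes. $\Gamma$ is an infinite Schottky group generated by hyperbolic isometries $(\gamma_n)_{n\ge1}$ if there are pairwise disjoint closed half-planes $D(\gamma_n),D(\gamma_n^{-1})$ ($n\ge 1$) such that $\gamma_n$ maps the complement of $D(\gamma_n^{-1})$ onto the interior of $D(\gamma_n)$. A hyperbolic surface $\Gamma\backslash\mathbb H$ is a flute if $\Gamma$ is an infinite Schottky group generated by a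 sequence $(\gamma_n)_{n\ge1}$ of hyperbolic isometries whose axes are nested (pairwise disjoint, each one separating the preceding ones from the following ones). For each $n$ let $a_n$ be the hyperbolic segment joining the axis of $\gamma_n$ to that of $\gamma_{n+1}$ and orthogonal to both. The flute is untwisted if all the segments $a_n$ lie on one same half-geodesic of $\mathbb H$. A geodesic ray $u(\mathbb R^+)$ is quasi-minimizing if there is $C\ge0$ with $d(u(0),u(t))\ge t-C$ for all $t>0$ (distance on the surface). It is infinite quasi-minimizing if it is quasi-minimizing and its initial vector $u$ lies in $\Omega_h$ and is not $h_{\mathbb R}$-periodic. For $x\in S$ with lift $\widetilde x\in\mathbb H$, $\mathrm{Inj}(x)=\inf_{\gamma\in\Gamma\setminus\{\mathrm{Id}\}}d(\widetilde x,\gamma\widetilde x)$. The asymptotic thinness of $u(\mathbb R^+)$ is $\mathrm{Inj}(u(\mathbb R^+))=\liminf_{t\to+\infty}\mathrm{Inj}(u(t))$. *)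

(* Defs.v *)
From HB Require Import structures.
From mathcomp Require Import all_boot all_order all_algebra generic_quotient.
From mathcomp Require Import all_classical all_reals all_analysis.
From mathcomp Require Import complex ring lra.

Set Implicit Arguments.
Unset Strict Implicit.
Unset Printing Implicit Defensive.

Import Order.TTheory GRing.Theory Num.Theory.
Import numFieldNormedType.Exports.

Local Open Scope classical_set_scope.
Local Open Scope ring_scope.
Local Open Scope quotient_scope.
Local Open Scope complex_scope.

Notation ReC := complex.Re.
Notation ImC := complex.Im.
Notation normc := ComplexField.Normc.normc.

(** Orientation-preserving isometries of the half-plane are represented by
    matrices of determinant 1; A and - A are the same isometry, so that "equal
    to the identity" has to be read on the action on the half-plane, see
    [acts_trivially] below. *)

Section SL2.
Variable R : realType.

Record SL2 := MkSL2 { slmx :> 'M[R]_2 ; _ : \det slmx == 1 }.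
HB.instance Definition _ := [isSub for slmx].
HB.instance Definition _ := [Choice of SL2 by <:].

Lemma sl_det (A : SL2) : \det A = 1. Proof. exact/eqP/(valP A). Qed.

Lemma det_mx2 (A : 'M[R]_2) : \det A = A 0 0 * A 1 1 - A 0 1 * A 1 0.
Proof.
rewrite (expand_det_row _ 0) !big_ord_recl big_ord0 addr0 /cofactor.
rewrite !det_mx11 !mxE /= expr0 expr1 mul1r mulN1r mulrN.
by congr (A _ _ * A _ _ - A _ _ * A _ _); apply/val_inj.
Qed.

Lemma mulmx2E (A B : 'M[R]_2) i j : (A *m B) i j = A i 0 * B 0 j + A i 1 * B 1 j.
Proof.
rewrite mxE !big_ord_recl big_ord0 addr0.
by congr (A _ _ * B _ _ + A _ _ * B _ _); apply/val_inj.
Qed.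

Lemma sl_detE (A : SL2) : A 0 0 * A 1 1 - A 0 1 * A 1 0 = 1.
Proof. by rewrite -det_mx2 sl_det. Qed.

Lemma sl_one_subproof : \det (1%:M : 'M[R]_2) == 1.
Proof. by rewrite det1. Qed.
Definition sl_one := MkSL2 sl_one_subproof.

Lemma sl_mul_subproof (A B : SL2) : \det (A *m B) == 1.
Proof. by rewrite det_mulmx !sl_det mulr1. Qed.
Definition sl_mul A B := MkSL2 (sl_mul_subproof A B).

Lemma sl_inv_subproof (A : SL2) : \det (invmx A) == 1.
Proof. by rewrite det_inv sl_det invr1. Qed.
Definition sl_inv A := MkSL2 (sl_inv_subproof A).

Lemma sl_mulVx A : sl_mul (sl_inv A) A = sl_one.
Proof. by apply/val_inj; rewrite /= mulVmx // unitmxE sl_det unitr1. Qed.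

Definition subgroup (G : set SL2) : Prop :=
  [/\ G sl_one,
      forall A B, G A -> G B -> G (sl_mul A B)
    & forall A, G A -> G (sl_inv A)].

Definition hyperbolic (A : SL2) : Prop := 2 < `|\tr A|.
Definition elliptic (A : SL2) : Prop := `|\tr A| < 2.

End SL2.

Section HalfPlane.
Variable R : realType.
Local Notation SL2 := (SL2 R).

Record HH := MkHH { hval :> R[i] ; _ : 0 < ImC hval }.
HB.instance Definition _ := [isSub for hval].
HB.instance Definition _ := [Choice of HH by <:].

Lemma Im_gt0 (z : HH) : 0 < ImC z. Proof. exact: (valP z). Qed.

Definition mob_den (A : SL2) (z : R[i]) : R[i] := (A 1 0)%:C * z + (A 1 1)%:C.

Definition mob_val (A : SL2) (z : R[i]) : R[i] :=
  ((A 0 0)%:C * z + (A 0 1)%:C) / mob_den A z.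

Let sqn (w : R[i]) := ReC w ^+ 2 + ImC w ^+ 2.

Let sqn_normc w : normc (w ^+ 2) = sqn w.
Proof.
rewrite expr2 ComplexField.Normc.normcM -expr2 /sqn; case: w => a b /=.
by rewrite sqr_sqrtr // addr_ge0 ?sqr_ge0.
Qed.

Let sqn_gt0 w : w != 0 -> 0 < sqn w.
Proof.
case: w => a b; rewrite eq_complex /= negb_and /sqn /= => /orP[] h.
  by rewrite ltr_pwDl ?sqr_ge0 // exprn_even_gt0.
by rewrite ltr_wpDl ?sqr_ge0 // exprn_even_gt0.
Qed.

Lemma mob_den_neq0 A (z : HH) : mob_den A z != 0.
Proof.
rewrite /mob_den; have:= sl_detE A; case: z => -[x y] /= y0 dA.
apply/eqP => /eqP; rewrite eq_complex /= !mul0r !(subr0, addr0).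
rewrite mulf_eq0 (gt_eqF y0) orbF => /andP[+ /eqP c0].
rewrite c0 mul0r add0r => /eqP d0; move: dA.
by rewrite c0 d0 !mulr0 subr0 => /esym/eqP; rewrite oner_eq0.
Qed.

Lemma Im_mob_val A (z : HH) : ImC (mob_val A z) = ImC z / sqn (mob_den A z).
Proof.
have := sqn_gt0 (mob_den_neq0 A z); have := sl_detE A.
rewrite /mob_val /mob_den /sqn; case: z => -[x y] /= y0.
rewrite !mul0r !(subr0, addr0) => dA h.
set D := (_ + _) in h *.
transitivity (y * (A 0 0 * A 1 1 - A 0 1 * A 1 0) / D); last by rewrite dA mulr1.
by ring.
Qed.

Lemma mob_subproof A (z : HH) : 0 < ImC (mob_val A z).
Proof. by rewrite Im_mob_val divr_gt0 ?Im_gt0 ?sqn_gt0 ?mob_den_neq0. Qed.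

Definition mob A z := MkHH (mob_subproof A z).

Lemma mob1 z : mob (sl_one R) z = z.
Proof.
apply/val_inj; rewrite /= /mob_val /mob_den /= !mxE /=.
by rewrite mul1r mul0r addr0 add0r divr1.
Qed.

Lemma mob_denM A B (z : HH) :
  mob_den (sl_mul A B) z = mob_den A (mob_val B z) * mob_den B z.
Proof.
rewrite /mob_val [RHS]mulrDl [in RHS]mulrA divfK ?mob_den_neq0 //.
by rewrite /mob_den /= !mulmx2E !rmorphD !rmorphM /=; ring.
Qed.

Lemma mobM A B z : mob (sl_mul A B) z = mob A (mob B z).
Proof.
apply/val_inj; rewrite [LHS]/= [RHS]/=.
have hB := mob_den_neq0 B z.
rewrite [LHS]/mob_val mob_denM.
have -> : (sl_mul A B 0 0)%:C * z + (sl_mul A B 0 1)%:C =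
    ((A 0 0)%:C * mob_val B z + (A 0 1)%:C) * mob_den B z.
  rewrite mulrDl -mulrA /mob_val divfK // /mob_den /=.
  by rewrite !mulmx2E !rmorphD !rmorphM /=; ring.
by rewrite -mulf_div divff // mulr1.
Qed.

(** A pair (z, v) with v of norm 1 for the metric |dz| / Im z. *)
Record T1H := MkT1 { t1val :> HH * R[i] ; _ : normc t1val.2 / ImC t1val.1 == 1 }.
HB.instance Definition _ := [isSub for t1val].
HB.instance Definition _ := [Choice of T1H by <:].

Definition foot (u : T1H) : HH := u.1.
Definition vec (u : T1H) : R[i] := u.2.

Definition coords (u : T1H) : (R * R) * (R * R) :=
  ((ReC (foot u), ImC (foot u)), (ReC (vec u), ImC (vec u))).
HB.instance Definition _ := Topological.copy T1H (initial_topology coords).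

(** The derivative of z |-> (a z + b) / (c z + d) is z |-> 1 / (c z + d)^2. *)
Lemma act_subproof A (u : T1H) :
  normc (vec u / mob_den A (foot u) ^+ 2) / ImC (mob A (foot u)) == 1.
Proof.
case: u => -[z v] hv0; have /eqP/= hv := hv0.
rewrite /foot /vec /= Im_mob_val.
have w0 := mob_den_neq0 A z; set w := mob_den A z in w0 *.
rewrite ComplexField.Normc.normcM ComplexField.Normc.normcV.
rewrite sqn_normc.
have z0 := Im_gt0 z; have s0 := sqn_gt0 w0.
by apply/eqP; rewrite -[RHS]hv; field; rewrite !gt_eqF.
Qed.

Definition act A u := MkT1 (t1val := (_, _)) (act_subproof A u).

Lemma act1 u : act (sl_one R) u = u.
Proof.
apply/val_inj; rewrite /= mob1 /mob_den !mxE /= mul0r add0r expr1n divr1.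
by rewrite /foot /vec; case: (t1val u).
Qed.

Lemma actM A B u : act (sl_mul A B) u = act A (act B u).
Proof.
apply/val_inj; rewrite /= /foot /vec /= mobM; congr (_, _).
by rewrite mob_denM exprMn invfM [X in _ * X]mulrC mulrA.
Qed.

(** The upward unit vector at s + i e^t. *)
Lemma upward_HH_subproof (s t : R) : 0 < ImC (s +i* expR t).
Proof. exact: expR_gt0. Qed.
Lemma upward_subproof (s t : R) :
  normc (0 +i* expR t) / ImC (MkHH (upward_HH_subproof s t)) == 1.
Proof.
by rewrite /= expr0n add0r sqrtr_sqr ger0_norm ?expR_ge0 // divff // expR_eq0.
Qed.
Definition upward s t : T1H := MkT1 (t1val := (_, _)) (upward_subproof s t).

Lemma frame_subproof (u : T1H) : exists A, act A (upward 0 0) = u.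
Proof.
case: u => -[z v] hv0; have /eqP/= hv := hv0.
have z0 := Im_gt0 z.
have nv : normc v = ImC z by rewrite -[RHS]mul1r -hv divfK ?gt_eqF.
have v0 : v != 0.
  apply: contraTneq z0 => v0; rewrite -nv v0.
  by rewrite ComplexField.Normc.normc0 ltxx.
pose w : R[i] := sqrtc ('i / v); pose n := hval z * w.
have w2 : w ^+ 2 = 'i / v by rewrite sqr_sqrtc.
have sw : sqn w = (ImC z)^-1.
  rewrite -sqn_normc w2 ComplexField.Normc.normcM ComplexField.Normc.normcV nv.
  by rewrite /= expr0n /= add0r expr1n sqrtr1 mul1r.
pose M : 'M[R]_2 := \matrix_(i, j)
  if i == 0 then if j == 0 then ImC n else ReC n
  else if j == 0 then ImC w else ReC w.
have dM : \det M == 1.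
  rewrite det_mx2 !mxE /=.
  apply/eqP; transitivity (ImC z * sqn w); last by rewrite sw divff ?gt_eqF.
  by rewrite /n /sqn; case: (hval z) (w) => x y [c d] /=; ring.
have i1 : 0 +i* expR 0 = 'i :> R[i] by rewrite expR0.
have rec (q : R[i]) : (ImC q)%:C * 'i + (ReC q)%:C = q.
  by case: q => c d; simpc.
have w0 : w != 0 by rewrite -sqrf_eq0 w2 mulf_neq0 ?invr_neq0 ?complexiE ?neq0Ci.
exists (MkSL2 dM); apply/val_inj => /=.
have dw : mob_den (MkSL2 dM) 'i = w by rewrite /mob_den /= !mxE /= rec.
congr (_, _).
  apply/val_inj; rewrite /= i1 /mob_val dw /= !mxE /= rec.
  by rewrite /n mulfK.
rewrite /foot /vec /= i1 dw w2 invfM invrK mulrA divff ?mul1r //.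
by rewrite complexiE neq0Ci.
Qed.

(** The matrix A, unique up to sign, such that A maps the upward unit vector at
    i to u. *)
Definition frame (u : T1H) : SL2 := xget (sl_one R) [set A | act A (upward 0 0) = u].

Lemma frameP u : act (frame u) (upward 0 0) = u.
Proof. by rewrite /frame; case: xgetP (frame_subproof u) => //= h []A /h. Qed.

Lemma foot_act A u : foot (act A u) = mob A (foot u). Proof. by []. Qed.
Lemma vec_act A u : vec (act A u) = vec u / mob_den A (foot u) ^+ 2.
Proof. by []. Qed.

Lemma act_stab A : act A (upward 0 0) = upward 0 0 -> forall u, act A u = u.
Proof.
have: vec (upward 0 0) = 'i by rewrite /vec /= expR0.
have: hval (foot (upward 0 0)) = 'i by rewrite /= expR0.
move: (upward 0 0) => e fi vi h.
have hz : mob_val A 'i = 'i by rewrite -{1}fi -[LHS]/(hval (foot (act A e))) h.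
have hv : 'i / mob_den A 'i ^+ 2 = 'i by have := vec_act A e; rewrite h fi vi.
move: hz hv; have i0 : 'i != 0 :> R[i] by rewrite complexiE neq0Ci.
have := sl_detE A; set a := A 0 0; set b := A 0 1; set c := A 1 0; set d := A 1 1.
rewrite /mob_val; set w := mob_den A 'i => dA hz hv.
have w2 : w ^+ 2 = 1.
  by apply: invr_inj; apply: (mulfI i0); rewrite hv invr1 mulr1.
have w0 : w != 0 by rewrite -sqrf_eq0 w2 oner_eq0.
have hn : a%:C * 'i + b%:C = 'i * w by have := congr1 (fun q => q * w) hz; rewrite /= divfK.
have wE : w = d +i* c by rewrite /w /mob_den -/c -/d; simpc.
move: w2 hn; rewrite wE expr2; simpc => -[h1 h2] [h3 h4].
have c0 : c = 0 by nra.
have d2 : d ^+ 2 = 1 by rewrite c0 in h1; nra.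
have b0 : b = 0 by rewrite h3 c0 oppr0.
have d0 : (d%:C != 0 :> R[i]).
  by rewrite -sqrf_eq0 -rmorphXn /= d2 oner_eq0.
have den z : mob_den A z = d%:C by rewrite /mob_den -/c -/d c0 mul0r add0r.
move=> u; apply/val_inj => /=; rewrite den -rmorphXn /= d2 divr1.
rewrite (_ : mob A (foot u) = foot u) /foot /vec; first by case: (t1val u).
apply/val_inj; rewrite /= /mob_val den -/a -/b b0 h4 addr0.
by rewrite mulrAC divff // mul1r.
Qed.

Lemma act_inj_frame A B u : act A (upward 0 0) = act B (upward 0 0) ->
  act A u = act B u.
Proof.
move=> h; have /act_stab/(_ u) : act (sl_mul (sl_inv B) A) (upward 0 0) = upward 0 0.
  by rewrite actM h -actM sl_mulVx act1.
rewrite actM => /(congr1 (act B)); rewrite -[LHS]actM.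
suff -> : sl_mul B (sl_inv B) = sl_one R by rewrite act1.
by apply/val_inj; rewrite /= mulmxV // unitmxE sl_det unitr1.
Qed.

(** Both flows commute with isometries; along the upward unit vector at i, the
    geodesic is t |-> i e^t and the horocycle centered at the forward
    endpoint oo is s |-> s + i. *)
Definition geod (t : R) (u : T1H) : T1H := act (frame u) (upward 0 t).
Definition horo (s : R) (u : T1H) : T1H := act (frame u) (upward s 0).

Lemma geod_act A t u : geod t (act A u) = act A (geod t u).
Proof. by rewrite -actM; apply: act_inj_frame; rewrite frameP actM frameP. Qed.

Lemma horo_act A s u : horo s (act A u) = act A (horo s u).
Proof. by rewrite -actM; apply: act_inj_frame; rewrite frameP actM frameP. Qed.

Lemma geod_upward t : geod t (upward 0 0) = upward 0 t.
Proof. by rewrite -[RHS]act1; apply: act_inj_frame; rewrite frameP act1. Qed.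

Lemma horo_upward s : horo s (upward 0 0) = upward s 0.
Proof. by rewrite -[RHS]act1; apply: act_inj_frame; rewrite frameP act1. Qed.

(** cosh d(z, w) = 1 + |z - w|^2 / (2 Im z Im w) *)
Definition arcosh (x : R) : R := ln (x + Num.sqrt (x ^+ 2 - 1)).
Definition hdist (z w : HH) : R :=
  arcosh (1 + normc (hval z - hval w) ^+ 2 / (2 * ImC z * ImC w)).

Definition line (u : T1H) : set HH := [set foot (geod t u) | t in setT].
Definition half_line (u : T1H) : set HH := [set foot (geod t u) | t in `[0, +oo[].
Definition segment (u : T1H) (l : R) : set HH :=
  [set foot (geod t u) | t in `[0, l]].

(** The half-planes on the right-hand side of [line u]. *)
Definition closed_half_plane (u : T1H) : set HH :=
  [set mob (frame u) z | z in [set z : HH | 0 <= ReC z]].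
Definition open_half_plane (u : T1H) : set HH :=
  [set mob (frame u) z | z in [set z : HH | 0 < ReC z]].

Definition orthogonal_vec (u v : T1H) : Prop :=
  foot u = foot v /\ ReC (vec u) * ReC (vec v) + ImC (vec u) * ImC (vec v) = 0.

Definition separates (L X Y : set HH) : Prop :=
  exists u, [/\ L = line u, X `<=` open_half_plane u
              & Y `<=` ~` closed_half_plane u].

(** A point of the boundary at infinity is [Some x] with x real, or [None] for
    the point oo; convergence is that of the Riemann sphere. *)
Definition tends_to_boundary (I : Type) (F : set_system I) (z : I -> HH)
    (xi : option R) : Prop :=
  match xi with
  | Some x => (ReC (z i) @[i --> F] --> x) /\ (ImC (z i) @[i --> F] --> (0 : R))
  | None => normc (z i) @[i --> F] --> +oo
  end.

Definition forward_endpoint (u : T1H) (xi : option R) : Prop :=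
  tends_to_boundary +oo%R (fun t => foot (geod t u)) xi.

Definition acts_trivially (A : SL2) : Prop := forall z, mob A z = z.

(** A hyperbolic isometry has exactly one invariant geodesic. *)
Definition axis (A : SL2) : set HH :=
  \bigcup_(u in [set u | mob A @` line u = line u]) line u.

End HalfPlane.

Arguments geod {R}.
Arguments horo {R}.

Record surface (R : realType) := Surface {
  Gam : set (SL2 R) ;
  Gam_subgroup : subgroup Gam ;
  Gam_discrete : forall A, Gam A -> isolated [set slmx B | B in Gam] (slmx A) ;
  Gam_no_elliptic : forall A, Gam A -> ~ elliptic A }.

Section OrbitSpace.
Variables (R : realType) (S : surface R) (X : choiceType).
Variable a : SL2 R -> X -> X.
Hypothesis a1 : forall x, a (sl_one R) x = x.
Hypothesis aM : forall A B x, a (sl_mul A B) x = a A (a B x).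

Definition orbit_rel : rel X := fun x y => `[< exists2 A, Gam S A & a A x = y >].

Lemma orbit_refl : reflexive orbit_rel.
Proof. by move=> x; apply/asboolP; exists (sl_one R); case: (Gam_subgroup S). Qed.

Lemma orbit_trans : transitive orbit_rel.
Proof.
move=> y x z /asboolP[A GA <-] /asboolP[B GB <-]; apply/asboolP.
by exists (sl_mul B A); [case: (Gam_subgroup S) => _ h _; exact: h|rewrite aM].
Qed.

Lemma orbit_sym : symmetric orbit_rel.
Proof.
suff h x y : orbit_rel x y -> orbit_rel y x by move=> x y; apply/idP/idP; exact: h.
move=> /asboolP[A GA <-]; apply/asboolP; exists (sl_inv A).
  by case: (Gam_subgroup S) => _ _; apply.
by rewrite -aM sl_mulVx a1.
Qed.

Definition orbit_equiv : equiv_rel X := EquivRel _ orbit_refl orbit_sym orbit_trans.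
Definition orbit_space : quotType X := {eq_quot orbit_equiv}.
End OrbitSpace.

Section Surfaces.
Variables (R : realType) (S : surface R).

Definition surf : quotType (HH R) := orbit_space S (@mob1 R) (@mobM R).

Definition T1 : topologicalType :=
  quotient_topology (orbit_space S (@act1 R) (@actM R)).

Definition proj_T1 (u : T1H R) : T1 := \pi_(quotient_topology
  (orbit_space S (@act1 R) (@actM R))) u.
Definition lift_T1 (u : T1) : T1H R :=
  @repr _ (quotient_topology (orbit_space S (@act1 R) (@actM R))) u.

Lemma proj_T1P u v :
  proj_T1 u = proj_T1 v <-> exists2 A, Gam S A & act A u = v.
Proof.
split; first by move=> /eqquotP/asboolP.
by move=> h; apply/eqquotP/asboolP.
Qed.

Lemma lift_T1K u : proj_T1 (lift_T1 u) = u.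
Proof. exact: reprK. Qed.

Lemma surf_piP (x y : HH R) :
  \pi_surf x = \pi_surf y <-> exists2 A, Gam S A & mob A x = y.
Proof.
split; first by move=> /eqquotP/asboolP.
by move=> h; apply/eqquotP/asboolP.
Qed.

Definition T1_foot (u : T1) : surf := \pi_surf (foot (lift_T1 u)).
Definition geodesic_flow (t : R) (u : T1) : T1 := proj_T1 (geod t (lift_T1 u)).
Definition horocyclic_flow (s : R) (u : T1) : T1 := proj_T1 (horo s (lift_T1 u)).

Lemma T1_foot_proj u : T1_foot (proj_T1 u) = \pi_surf (foot u).
Proof.
have /proj_T1P[A GA hA] := lift_T1K (proj_T1 u).
by apply/surf_piP; exists A => //; rewrite -foot_act hA.
Qed.

Lemma geodesic_flow_proj t u : geodesic_flow t (proj_T1 u) = proj_T1 (geod t u).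
Proof.
have /proj_T1P[A GA hA] := lift_T1K (proj_T1 u).
by apply/proj_T1P; exists A => //; rewrite -geod_act hA.
Qed.

Lemma horocyclic_flow_proj s u : horocyclic_flow s (proj_T1 u) = proj_T1 (horo s u).
Proof.
have /proj_T1P[A GA hA] := lift_T1K (proj_T1 u).
by apply/proj_T1P; exists A => //; rewrite -horo_act hA.
Qed.

Definition horocyclic_orbit (u : T1) : set T1 :=
  [set horocyclic_flow s u | s in setT].
Definition horocyclic_periodic (u : T1) : Prop :=
  exists2 s : R, s != 0 & horocyclic_flow s u = u.

Definition limit_set : set (option R) :=
  [set xi | exists z : HH R, exists A : nat -> SL2 R,
     (forall n, Gam S (A n)) /\ tends_to_boundary \oo (fun n => mob (A n) z) xi].

Definition Omega_h : set T1 :=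
  [set u | exists2 xi, forward_endpoint (lift_T1 u) xi & limit_set xi].

Definition surf_dist (x y : surf) : R :=
  inf [set hdist (repr x) (mob A (repr y)) | A in Gam S].

Definition Inj (x : surf) : \bar R :=
  ereal_inf [set (hdist (repr x) (mob A (repr x)))%:E |
             A in [set A | Gam S A /\ ~ acts_trivially A]].

Definition ray (u : T1) (t : R) : surf := T1_foot (geodesic_flow t u).

Definition quasi_minimizing (u : T1) : Prop :=
  exists2 C : R, 0 <= C & forall t, 0 < t -> surf_dist (ray u 0) (ray u t) >= t - C.

Definition infinite_quasi_minimizing (u : T1) : Prop :=
  [/\ quasi_minimizing u, Omega_h u & ~ horocyclic_periodic u].

Definition asymptotic_thinness (u : T1) : \bar R :=
  limf_einf (fun t : R => Inj (ray u t)) +oo%R.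

(** [D n true] and [D n false] bound the half-planes attached to [g n] and to its
    inverse. *)
Definition schottky_generators (g : nat -> SL2 R) : Prop :=
  [/\ forall n, hyperbolic (g n),
      Gam S = smallest (@subgroup R) (range g)
    & exists D : nat -> bool -> T1H R,
        trivIset setT (fun k : nat * bool => closed_half_plane (D k.1 k.2)) /\
        forall n, mob (g n) @` (~` closed_half_plane (D n false)) =
                  open_half_plane (D n true)].

Definition nested (L : nat -> set (HH R)) : Prop :=
  trivIset setT L /\
  forall m n k, (m < n < k)%N -> separates (L n) (L m) (L k).

(** The segment with initial unit vector u and length l is the common
    perpendicular of L and L'. *)
Definition common_perpendicular (L L' : set (HH R)) (u : T1H R) (l : R) : Prop :=
  [/\ 0 < l,
      exists2 v, L = line v & orthogonal_vec u v
    & exists2 v, L' = line v & orthogonal_vec (geod l u) v].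

Definition flute_generators (g : nat -> SL2 R) : Prop :=
  schottky_generators g /\ nested (fun n => axis (g n)).

Definition untwisted (g : nat -> SL2 R) : Prop :=
  exists v, forall n, exists u l,
    common_perpendicular (axis (g n)) (axis (g n.+1)) u l /\
    segment u l `<=` half_line v.

Definition untwisted_flute : Prop :=
  exists g, flute_generators g /\ untwisted g.

End Surfaces.

(* Main.v *)
Require Import Defs.
From mathcomp Require Import all_boot all_order all_algebra.
From mathcomp Require Import all_classical all_reals all_analysis.
From mathcomp Require Import complex ring lra zify.

Import Order.TTheory GRing.Theory Num.Theory.
Import numFieldNormedType.Exports.
Local Open Scope classical_set_scope.
Local Open Scope ring_scope.
Local Open Scope complex_scope.
Local Open Scope quotient_scope.

Set Implicit Arguments.
Unset Strict Implicit.

(** The flute is built from inversions. Let C_0 be the unit circle and let C_1,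
    C_2, ... be disjoint circles centered on the positive real axis, each of them
    far beyond the preceding ones, with center c_n and radius r_n such that c_n /
    r_n tends quickly to 1. At heights between c_n - r_n and c_n the circle C_n is
    almost the vertical geodesic from 0 to infinity, but it is far from the other
    circles there. Let s_n be the inversion in C_n. The group consists of the even
    words in the s_n; it is generated by the products s_n s_0 with n > 0, whose
    axes are the common perpendiculars of C_0 and C_n. These axes are nested and
    all of them are orthogonal to C_0, which contains all the segments a_n: the
    flute is untwisted. The vector u is the upward vector at i. Its endpoint,
    infinity, is a limit point because the discs bounded by the C_n go to
    infinity.

    A matrix A of the group with first column (a, c) carries the horocycle of u to
    the one based at a / c with diameter 1 / c^2, and g_t u is in the closure of
    the orbit of u exactly when there are such columns with c tending to 0 and a^2
    tending to e^t. Everything follows from an estimate of these columns,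
    [word_growth]. For the reduced word s_n s_m ... with n > 0 the number a / c
    lies in the n-th disc, and the entry c is bounded below in terms of n. If the
    letters of the word increase, then |a| lies between 1 and the product of the
    ratios c_k / r_k for k >= n, which is close to 1 when n is large; if they do
    not, then |a| is at least n + 3. The entry d is the entry a of the reversed
    word, and a word of length at least two and its reverse are not both
    increasing.

    - If A is close to the identity then c is small, so that the first and last
      letters of the word are positive, and a or d is at least 4: the group is
      discrete. In the same way, a cyclically reduced word has a trace of modulus
      at least 2.
    - If c is small, the first letter is large, and a^2 is either large or close
      to 1. Hence g_t u is in the closure only for t = 0; since g_1 u also points
      to infinity, the orbit is not dense in the nonwandering set
      ([geodesic_flow_not_in_closure]).
    - The displacement of i h under A is at least ln ((a^2 + d^2 + c^2 h^2) / 2).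
      When h is large, either c h is large, or c is small and then a or d is
      large: the ray is infinitely thick ([thinness_infinite]). The ray is
      quasi-minimizing because a^2 + c^2 is bounded below, and u is not periodic
      because c vanishes only for the identity.
    - Along the words s_1 s_2 ... s_(2k) the diameters 1 / c^2 stay in a compact
      set of positive numbers. The corresponding horocycles accumulate on a
      horocycle whose base point is coded by the infinite word s_1 s_2 s_3 ...;
      such a point is not in the orbit of infinity, hence the orbit of u is not
      closed ([horocyclic_orbit_not_closed]). *)

(** * Moebius maps in real coordinates *)

Section HalfPlaneCalculus.
Variable R : realType.
Local Notation SL2 := (SL2 R).
Local Notation HH := (HH R).
Local Notation T1H := (T1H R).
Local Notation e0 := (upward (0 : R) 0).

Definition mx2 (a b c d : R) : 'M[R]_2 := \matrix_(i, j)
  if i == 0 then if j == 0 then a else b else if j == 0 then c else d.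

Lemma sl2_subproof (a b c d : R) (h : a * d - b * c = 1) : \det (mx2 a b c d) == 1.
Proof. by rewrite det_mx2 !mxE /=; apply/eqP. Qed.
Definition sl2 a b c d h : SL2 := MkSL2 (@sl2_subproof a b c d h).

Lemma sl_mulE (A B : SL2) i j : sl_mul A B i j = A i 0 * B 0 j + A i 1 * B 1 j.
Proof. exact: mulmx2E. Qed.

Lemma sl_mulxV (A : SL2) : sl_mul A (sl_inv A) = sl_one R.
Proof. by apply/val_inj; rewrite /= mulmxV // unitmxE sl_det unitr1. Qed.

Lemma sl_mulKV (A B : SL2) : sl_mul A (sl_mul (sl_inv A) B) = B.
Proof.
by apply/val_inj; rewrite /= mulmxA mulmxV ?mul1mx // unitmxE sl_det unitr1.
Qed.

Lemma mx2_eq (A B : 'M[R]_2) : A 0 0 = B 0 0 -> A 0 1 = B 0 1 ->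
  A 1 0 = B 1 0 -> A 1 1 = B 1 1 -> A = B.
Proof.
move=> h1 h2 h3 h4; apply/matrixP => i j.
have o (k : 'I_2) : k = 0 \/ k = 1.
  by case: k => [[|[|//]] ?]; [left|right]; exact/val_inj.
by case: (o i) => ->; case: (o j) => ->.
Qed.

Lemma sl_inv_entries (C : SL2) : slmx (sl_inv C) = mx2 (C 1 1) (- C 0 1) (- C 1 0) (C 0 0).
Proof.
have h : mx2 (C 1 1) (- C 0 1) (- C 1 0) (C 0 0) *m C = 1%:M.
  have := sl_detE C => dC.
  apply: mx2_eq; rewrite mulmx2E !mxE /= -?dC; ring.
by rewrite /= -[invmx C]mul1mx -h -mulmxA mulmxV ?mulmx1 // unitmxE sl_det unitr1.
Qed.

(** The squared modulus of the denominator c z + d. *)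
Definition den2 (A : SL2) (z : HH) : R :=
  (A 1 0 * ReC z + A 1 1) ^+ 2 + (A 1 0 * ImC z) ^+ 2.

Lemma den2_gt0 A z : 0 < den2 A z.
Proof.
have := mob_den_neq0 A z; rewrite /mob_den /den2; case: z => -[x y] /= y0.
rewrite eq_complex /= !mul0r !(subr0, addr0) negb_and => /orP[] h.
  by rewrite ltr_pwDl ?sqr_ge0 // exprn_even_gt0.
by rewrite ltr_wpDl ?sqr_ge0 // exprn_even_gt0.
Qed.

Lemma mob_valE A (z : HH) : mob_val A z =
  (((A 0 0 * ReC z + A 0 1) * (A 1 0 * ReC z + A 1 1) +
     A 0 0 * A 1 0 * ImC z ^+ 2) / den2 A z) +i* (ImC z / den2 A z).
Proof.
have := den2_gt0 A z; have := sl_detE A.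
rewrite /mob_val /den2 /mob_den; case: z => -[x y] /= y0.
simpc; rewrite /= => dA D0.
move: (A 0 0) (A 0 1) (A 1 0) (A 1 1) dA D0 => a b c d dA; set D := (_ + _) => D0.
by congr (_ +i* _); [|rewrite -[y in RHS]mul1r -dA]; ring.
Qed.

Lemma Re_mob A z : ReC (mob A z) =
  ((A 0 0 * ReC z + A 0 1) * (A 1 0 * ReC z + A 1 1) +
     A 0 0 * A 1 0 * ImC z ^+ 2) / den2 A z.
Proof. by rewrite /= mob_valE. Qed.

Lemma Im_mob A z : ImC (mob A z) = ImC z / den2 A z.
Proof. by rewrite [LHS]/= mob_valE. Qed.

Lemma HH_eq (z w : HH) : ReC z = ReC w -> ImC z = ImC w -> z = w.
Proof.
move=> h1 h2; apply/val_inj => /=.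
by case: z w h1 h2 => -[x y] ? [[x' y'] ?] /= -> ->.
Qed.

Lemma coords_inj : injective (@coords R).
Proof.
move=> [[z v] hu] [[z' v'] hu'] [/= h1 h2 h3 h4]; apply/val_inj => /=.
congr (_, _); first exact: HH_eq.
by move: h3 h4; rewrite /vec /=; clear; case: v v' => ? ? [? ?] /= -> ->.
Qed.

Lemma Im_upward s t : ImC (foot (upward s t : T1H)) = expR t. Proof. by []. Qed.
Lemma Re_upward s t : ReC (foot (upward s t : T1H)) = s. Proof. by []. Qed.
Lemma vec_upward s t : vec (upward s t : T1H) = 0 +i* expR t. Proof. by []. Qed.

Lemma act_upward_coords (A : SL2) (s t : R) (E := expR t)
  (p := A 1 0 * s + A 1 1) (q := A 1 0 * E) (D := p ^+ 2 + q ^+ 2) :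
  coords (act A (upward s t)) =
   ((((A 0 0 * s + A 0 1) * p + A 0 0 * q * E) / D, E / D),
    (E * (2 * p * q) / D ^+ 2, E * (p ^+ 2 - q ^+ 2) / D ^+ 2)).
Proof.
have D0 : D != 0 by rewrite gt_eqF //; exact: (den2_gt0 A (foot (upward s t))).
rewrite /coords foot_act Re_mob Im_mob vec_act /den2 Im_upward Re_upward vec_upward.
rewrite -/E -/p -/q -/D.
have -> : mob_den A (foot (upward s t)) = p +i* q.
  by rewrite /mob_den /=; simpc.
congr ((_, _), _); first by congr (_ / _); rewrite /q; ring.
have -> : (0 +i* E) / (p +i* q) ^+ 2 =
   (E * (2 * p * q) / D ^+ 2) +i* (E * (p ^+ 2 - q ^+ 2) / D ^+ 2) :> R[i].
  apply: (@mulIf _ ((p +i* q) ^+ 2)); last first.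
    rewrite divfK; last first.
      rewrite sqrf_eq0 eq_complex /=; apply: contra D0 => /andP[/eqP p0 /eqP q0].
      by rewrite /D p0 q0 !expr0n /= addr0.
    rewrite expr2; simpc; congr (_ +i* _); rewrite /D; field; exact: D0.
  rewrite sqrf_eq0 eq_complex /=; apply: contra D0 => /andP[/eqP p0 /eqP q0].
  by rewrite /D p0 q0 !expr0n /= addr0.
by [].
Qed.

End HalfPlaneCalculus.

(** * Horocycles as first columns *)

Section HorocycleColumn.
Variable R : realType.
Local Notation SL2 := (SL2 R).
Local Notation T1H := (T1H R).
Local Notation e0 := (upward (0 : R) 0).

(** The quantities a^2, a c and c^2, where (a, c) is the first column of the
    matrix carrying the upward vector at i to u. That matrix is unique up to sign,
    so these products are functions of u; they are written in coordinates so that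
    their continuity is visible. Since the horocycle flow multiplies the matrix on
    the right by unipotent upper triangular ones, they are constant on horocycles,
    and they separate horocycles. *)
Definition col_aa (u : T1H) : R :=
  let x := (coords u).1.1 in let y := (coords u).1.2 in
  let v1 := (coords u).2.1 in let v2 := (coords u).2.2 in
  ((x * x + y * y) / y - ((x * x - y * y) * v2 - 2 * x * y * v1) / (y * y)) / 2.
Definition col_ac (u : T1H) : R :=
  let x := (coords u).1.1 in let y := (coords u).1.2 in
  let v1 := (coords u).2.1 in let v2 := (coords u).2.2 in
  (x / y - (x * v2 - y * v1) / (y * y)) / 2.
Definition col_cc (u : T1H) : R :=
  let y := (coords u).1.2 in let v2 := (coords u).2.2 in (y - v2) / (2 * (y * y)).

(** The foot and the vector have denominators p^2 + c^2 with p = c s + d, and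
    numerators in which the determinant a p - b' c = 1 is hidden: this is why the
    identities are first proved with a free e equal to that determinant. *)
Lemma col_act_upward (A : SL2) s (u := act A (upward s 0)) :
  [/\ col_aa u = A 0 0 ^+ 2, col_ac u = A 0 0 * A 1 0 & col_cc u = A 1 0 ^+ 2].
Proof.
rewrite /col_aa /col_ac /col_cc -!expr2 act_upward_coords expR0.
have := den2_gt0 A (foot (upward s 0)); rewrite /den2 Im_upward Re_upward expR0.
have := sl_detE A; rewrite !mulr1 !mul1r.
move: (A 0 0) (A 0 1) (A 1 0) (A 1 1) => a b c d dA.
have : a * (c * s + d) - (a * s + b) * c = 1 by rewrite -dA; ring.
move: (c * s + d) (a * s + b) => p b' {}dA D0; clear b d.
have D1 : p ^+ 2 + c ^+ 2 != 0 by rewrite gt_eqF.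
split.
- have h (e : R) : e = a * p - b' * c -> e != 0 ->
    ((((b' * p + a * c) / (p ^+ 2 + c ^+ 2)) ^+ 2 + (e / (p ^+ 2 + c ^+ 2)) ^+ 2) /
      (1 / (p ^+ 2 + c ^+ 2)) -
     ((((b' * p + a * c) / (p ^+ 2 + c ^+ 2)) ^+ 2 - (e / (p ^+ 2 + c ^+ 2)) ^+ 2) *
      ((p ^+ 2 - c ^+ 2) / (p ^+ 2 + c ^+ 2) ^+ 2) -
     2 * ((b' * p + a * c) / (p ^+ 2 + c ^+ 2)) * (e / (p ^+ 2 + c ^+ 2)) *
      (2 * p * c / (p ^+ 2 + c ^+ 2) ^+ 2)) / (1 / (p ^+ 2 + c ^+ 2)) ^+ 2) / 2 = a ^+ 2.
    by move=> -> _; field; rewrite ?D1 ?oner_neq0.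
  by have := h 1 (esym dA) (oner_neq0 _); rewrite !mul1r.
- transitivity (a * c * (a * p - b' * c)); last by rewrite dA mulr1.
  have h (e : R) : e = a * p - b' * c ->
    ((b' * p + a * c) / (p ^+ 2 + c ^+ 2) / (1 / (p ^+ 2 + c ^+ 2)) -
     ((b' * p + a * c) / (p ^+ 2 + c ^+ 2) * ((p ^+ 2 - c ^+ 2) / (p ^+ 2 + c ^+ 2) ^+ 2) -
     e / (p ^+ 2 + c ^+ 2) * (2 * p * c / (p ^+ 2 + c ^+ 2) ^+ 2)) / (1 / (p ^+ 2 + c ^+ 2)) ^+ 2) / 2
    = a * c.
    by move=> ->; field; rewrite ?D1 ?oner_neq0.
  by have := h 1 (esym dA); rewrite !mul1r dA mulr1.
- by rewrite /=; field; rewrite ?D1 ?oner_neq0.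
Qed.

Lemma frame_col (u : T1H) :
  [/\ col_aa u = frame u 0 0 ^+ 2, col_ac u = frame u 0 0 * frame u 1 0
    & col_cc u = frame u 1 0 ^+ 2].
Proof. by rewrite -{1 3 6}(frameP u); exact: col_act_upward. Qed.

(** The symmetric square of a column transforms linearly, which makes the
    continuity of v |-> col_aa (act A v) a consequence of that of the three
    functions. *)
Lemma col_act (A : SL2) (u : T1H) :
  col_aa (act A u) = A 0 0 ^+ 2 * col_aa u + 2 * A 0 0 * A 0 1 * col_ac u
    + A 0 1 ^+ 2 * col_cc u /\
  col_cc (act A u) = A 1 0 ^+ 2 * col_aa u + 2 * A 1 0 * A 1 1 * col_ac u
    + A 1 1 ^+ 2 * col_cc u.
Proof.
have [-> -> ->] := frame_col u.
have [+ _ +] := col_act_upward (sl_mul A (frame u)) 0.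
rewrite actM frameP => -> ->; rewrite /= !mulmx2E; split; ring.
Qed.

Lemma col_upward t : col_aa (upward 0 t : T1H) = expR t /\ col_cc (upward 0 t : T1H) = 0.
Proof.
have E0 : expR t != 0 by rewrite gt_eqF // expR_gt0.
rewrite /col_aa /col_cc -!expr2 /= subrr mul0r; split=> //.
by field.
Qed.

Lemma coords_continuous (u : T1H) :
  [/\ (fun v : T1H => ReC (foot v)) v @[v --> u] --> ReC (foot u),
      (fun v : T1H => ImC (foot v)) v @[v --> u] --> ImC (foot u),
      (fun v : T1H => ReC (vec v)) v @[v --> u] --> ReC (vec u)
    & (fun v : T1H => ImC (vec v)) v @[v --> u] --> ImC (vec u)].
Proof.
have h : (coords v) @[v --> u] --> coords u by exact: initial_continuous.
have h1 : (coords v).1 @[v --> u] --> (coords u).1 by apply: cvg_comp h _; exact: cvg_fst.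
have h2 : (coords v).2 @[v --> u] --> (coords u).2 by apply: cvg_comp h _; exact: cvg_snd.
split.
- by apply: (cvg_comp (fun v : T1H => (coords v).1) fst h1); exact: cvg_fst.
- by apply: (cvg_comp (fun v : T1H => (coords v).1) snd h1); exact: cvg_snd.
- by apply: (cvg_comp (fun v : T1H => (coords v).2) fst h2); exact: cvg_fst.
- by apply: (cvg_comp (fun v : T1H => (coords v).2) snd h2); exact: cvg_snd.
Qed.

Lemma col_continuous (u : T1H) : [/\ col_aa v @[v --> u] --> col_aa u,
  col_ac v @[v --> u] --> col_ac u & col_cc v @[v --> u] --> col_cc u].
Proof.
have [cx cy c1 c2] := coords_continuous u.
have y0 : ImC (foot u) != 0 by rewrite gt_eqF // Im_gt0.
have y2 : ImC (foot u) * ImC (foot u) != 0 by rewrite mulf_neq0.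
have cyv : (ImC (foot v))^-1 @[v --> u] --> (ImC (foot u))^-1 by exact: cvgV y0 cy.
have c2y2 : (2 * (ImC (foot v) * ImC (foot v)))^-1 @[v --> u] -->
    (2 * (ImC (foot u) * ImC (foot u)))^-1.
  have y22 : 2 * (ImC (foot u) * ImC (foot u)) != 0 by rewrite ?mulf_neq0 ?pnatr_eq0.
  exact: (cvgV y22 (cvgM (cvg_cst _) (cvgM cy cy))).
have cy2v : (ImC (foot v) * ImC (foot v))^-1 @[v --> u] -->
    (ImC (foot u) * ImC (foot u))^-1.
  exact: (cvgV y2 (cvgM cy cy)).
split.
- exact: (cvgM (cvgB (cvgM (cvgD (cvgM cx cx) (cvgM cy cy)) cyv)
    (cvgM (cvgB (cvgM (cvgB (cvgM cx cx) (cvgM cy cy)) c2)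
      (cvgM (cvgM (cvgM (cvg_cst _) cx) cy) c1)) cy2v)) (cvg_cst _)).
- exact: (cvgM (cvgB (cvgM cx cyv) (cvgM (cvgB (cvgM cx c2) (cvgM cy c1)) cy2v)) (cvg_cst _)).
- exact: (cvgM (cvgB cy c2) c2y2).
Qed.

Lemma col_act_continuous (A : SL2) (u : T1H) :
  col_aa (act A v) @[v --> u] --> col_aa (act A u) /\
  col_cc (act A v) @[v --> u] --> col_cc (act A u).
Proof.
have [aa ac cc] := col_continuous u.
split.
  rewrite (col_act A u).1; under eq_fun do rewrite (col_act A _).1.
  exact: (cvgD (cvgD (cvgM (cvg_cst _) aa) (cvgM (cvg_cst _) ac)) (cvgM (cvg_cst _) cc)).
rewrite (col_act A u).2; under eq_fun do rewrite (col_act A _).2.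
exact: (cvgD (cvgD (cvgM (cvg_cst _) aa) (cvgM (cvg_cst _) ac)) (cvgM (cvg_cst _) cc)).
Qed.

Lemma horocyclic_orbit_proj (S : surface R) (p : T1 S) :
  horocyclic_orbit (proj_T1 S e0) p <-> exists s, p = proj_T1 S (upward s 0).
Proof.
split=> [[s _ <-]|[s ->]]; first by exists s; rewrite horocyclic_flow_proj horo_upward.
by exists s => //; rewrite horocyclic_flow_proj horo_upward.
Qed.

Lemma geodesic_flow_upward (S : surface R) t :
  geodesic_flow t (proj_T1 S e0) = proj_T1 S (upward 0 t).
Proof. by rewrite geodesic_flow_proj geod_upward. Qed.

(** The conditions on col_cc and col_aa define an open set of vectors around the
    upward vector at height e^t. Its image in the quotient is open because its
    saturation is a union of preimages under continuous maps, and it misses the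
    orbit since the horocycles of the orbit have squared columns (A 0 0 ^+ 2, A 1
    0 ^+ 2). *)
Lemma not_closure_horocyclic_orbit (S : surface R) (t eta eps : R) : 0 < eta -> 0 < eps ->
  (forall A, Gam S A -> A 1 0 ^+ 2 < eta -> eps <= `|expR t - A 0 0 ^+ 2|) ->
  ~ closure (horocyclic_orbit (proj_T1 S e0)) (geodesic_flow t (proj_T1 S e0)).
Proof.
move=> eta0 eps0 hA; rewrite geodesic_flow_upward => hcl.
have [G1 GM GV] := Gam_subgroup S.
pose U : set (T1 S) := [set p | exists v, [/\ proj_T1 S v = p, col_cc v < eta
   & `|expR t - col_aa v| < eps]].
have oU : open U.
  rewrite /open/= /quotient_open.
  rewrite [X in open X](_ : _ = \bigcup_(A in Gam S)
    ([set v | col_cc (act A v) < eta] `&` [set v | `|expR t - col_aa (act A v)| < eps])).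
    apply: bigcup_open => A GA; apply: openI.
      rewrite openE => v hv; rewrite /interior.
      exact: (cvgr_lt _ (col_act_continuous A v).2 _ hv).
    rewrite openE => v hv; rewrite /interior.
    have hn : `|expR t - col_aa (act A w)| @[w --> v] --> `|expR t - col_aa (act A v)|.
      exact: (cvg_norm (cvgB (cvg_cst _) (col_act_continuous A v).1)).
    exact: (cvgr_lt _ hn _ hv).
  apply/seteqP; split=> v.
    move=> [v' [/esym/proj_T1P[A GA <-] h1 h2]]; by exists A.
  move=> [A GA [h1 h2]]; exists (act A v); split=> //.
  by apply/esym/proj_T1P; exists A.
have [aa cc] := col_upward t.
have Ut : nbhs (proj_T1 S (upward 0 t)) U.
  apply: open_nbhs_nbhs; split=> //; exists (upward 0 t).
  by rewrite aa cc subrr normr0.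
have [p [/horocyclic_orbit_proj[s ->] [v [/esym/proj_T1P[A GA <-]]]]] := hcl _ Ut.
have [-> _ ->] := col_act_upward A s => h1 h2.
by have := hA A GA h1; rewrite leNgt h2.
Qed.
End HorocycleColumn.

(** * Distances and convergence to the boundary *)

Section Distance.
Variable R : realType.
Local Notation SL2 := (SL2 R).
Local Notation HH := (HH R).
Local Notation T1H := (T1H R).
Local Notation e0 := (upward (0 : R) 0).

Lemma normc_sqr (w : R[i]) : normc w ^+ 2 = ReC w ^+ 2 + ImC w ^+ 2.
Proof. by case: w => x y /=; rewrite sqr_sqrtr // addr_ge0 ?sqr_ge0. Qed.

Lemma normc_ge0 (w : R[i]) : 0 <= normc w.
Proof. by case: w => x y /=; exact: sqrtr_ge0. Qed.

Lemma Re_le_normc (w : R[i]) : `|ReC w| <= normc w.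
Proof.
rewrite -(@ler_pXn2r _ 2) ?nnegrE ?normc_ge0 // normc_sqr real_normK ?num_real //.
by rewrite lerDl sqr_ge0.
Qed.

Definition cosh_dist (z w : HH) : R :=
  1 + normc (hval z - hval w) ^+ 2 / (2 * ImC z * ImC w).

Lemma normc_mob_den A (z : HH) : normc (mob_den A z) ^+ 2 = den2 A z.
Proof.
by rewrite normc_sqr /mob_den /den2; case: z => -[x y] /= y0; simpc; rewrite /=.
Qed.

Lemma cosh_dist_mob A z w : cosh_dist (mob A z) (mob A w) = cosh_dist z w.
Proof.
rewrite /cosh_dist !Im_mob.
have := den2_gt0 A z; have := den2_gt0 A w.
have -> : hval (mob A z) - hval (mob A w) =
    (hval z - hval w) / (mob_den A z * mob_den A w).
  have := mob_den_neq0 A z; have := mob_den_neq0 A w.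
  rewrite /= /mob_val => w0 z0.
  have dA : (A 0 0)%:C * (A 1 1)%:C - (A 0 1)%:C * (A 1 0)%:C = 1 :> R[i].
    by rewrite -!rmorphM -rmorphB /= sl_detE.
  rewrite -[hval z - hval w]mulr1 -dA; move: w0 z0; rewrite /mob_den.
  by move: (hval z) (hval w) => x y w0 z0; field; rewrite w0 z0.
rewrite ComplexField.Normc.normcM ComplexField.Normc.normcV ComplexField.Normc.normcM.
rewrite !exprMn exprVn exprMn !normc_mob_den.
have := Im_gt0 z; have := Im_gt0 w.
by move=> h1 h2 h3 h4; congr (1 + _); field; rewrite !gt_eqF.
Qed.

Lemma hdist_mob (A : SL2) (z w : HH) : hdist (mob A z) (mob A w) = hdist z w.
Proof. by have := cosh_dist_mob A z w; rewrite /hdist /cosh_dist => ->. Qed.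

Lemma cosh_dist_upward (A : SL2) (s t : R) :
  cosh_dist (foot (upward 0 s)) (mob A (foot (upward 0 t))) =
  (A 0 0 ^+ 2 * expR t / expR s + A 0 1 ^+ 2 / (expR s * expR t)
   + A 1 0 ^+ 2 * (expR s * expR t) + A 1 1 ^+ 2 * expR s / expR t) / 2.
Proof.
have sub (p q : R[i]) : (ReC (p - q) = ReC p - ReC q) * (ImC (p - q) = ImC p - ImC q).
  by case: p q => ? ? [? ?].
rewrite /cosh_dist normc_sqr !sub Re_mob Im_mob.
have := den2_gt0 A (foot (upward 0 t)).
rewrite /den2 !Re_upward !Im_upward.
have := sl_detE A.
move: (A 0 0) (A 0 1) (A 1 0) (A 1 1) => a b c d.
have := expR_gt0 s; have := expR_gt0 t.
move: (expR s) (expR t) => S T T0 S0 dA; rewrite !mulr0 !add0r => D0.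
have D1 : d ^+ 2 + (c * T) ^+ 2 != 0 by rewrite gt_eqF.
have h (e : R) : e = a * d - b * c ->
  (e + ((- ((b * d + a * c * T ^+ 2) / (d ^+ 2 + (c * T) ^+ 2))) ^+ 2 +
  (S - (e * T) / (d ^+ 2 + (c * T) ^+ 2)) ^+ 2) / (2 * S * (T / (d ^+ 2 + (c * T) ^+ 2)))) =
  (a ^+ 2 * T / S + b ^+ 2 / (S * T) + c ^+ 2 * (S * T) + d ^+ 2 * S / T) / 2.
  by move=> ->; field; rewrite D1 !gt_eqF.
by have := h 1 (esym dA); rewrite !mul1r.
Qed.

(** Inverse hyperbolic cosine dominates the logarithm. *)
Lemma hdist_ge_ln (z w : HH) (k : R) : 0 < k -> k <= cosh_dist z w -> ln k <= hdist z w.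
Proof.
move=> k0 h; rewrite /hdist -/(cosh_dist z w) /arcosh.
by rewrite ler_ln ?posrE //; have := sqrtr_ge0 (cosh_dist z w ^+ 2 - 1); lra.
Qed.

(** Indeed A z - a / c = - 1 / (c (c z + d)), and both its real and imaginary
    parts are bounded by 1 / (|c| |c z + d|). *)
Lemma tends_mob (I : Type) (F : set_system I) (z : I -> HH) (A : SL2) :
  Filter F -> A 1 0 != 0 -> tends_to_boundary F z None ->
  tends_to_boundary F (fun i => mob A (z i)) (Some (A 0 0 / A 1 0)).
Proof.
move=> FF c0 /cvgryPge h.
have den2_ge i : A 1 0 ^+ 2 * normc (z i) ^+ 2 / 2 - A 1 1 ^+ 2 <= den2 A (z i).
  rewrite normc_sqr /den2 -subr_ge0.
  move: (A 1 0) (A 1 1) (ReC _) (ImC _) => c d x y.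
  have := sqr_ge0 (c * x + 2 * d); have := sqr_ge0 (c * y); lra.
have k0 : 0 < A 1 0 ^+ 2 by rewrite exprn_even_gt0.
have key (e : R) : 0 < e -> \forall i \near F, 1 / (A 1 0 ^+ 2 * den2 A (z i)) < e ^+ 2.
  move=> ep; have e2 : 0 < e ^+ 2 by rewrite exprn_gt0.
  near=> i; rewrite ltr_pdivrMr ?(mulr_gt0 k0 (den2_gt0 _ _)) //.
  have hB : 1 + 2 * (A 1 1 ^+ 2 + 2 / (A 1 0 ^+ 2 * e ^+ 2)) / A 1 0 ^+ 2 <= normc (z i).
    by near: i; exact: h.
  have := den2_ge i; move: hB; have := sqr_ge0 (A 1 1).
  move: (A 1 0 ^+ 2) (A 1 1 ^+ 2) (normc (z i)) (den2 A (z i)) (e ^+ 2) k0 e2.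
  move=> {den2_ge} k D N X E k0 E0 D0 hB hX.
  set V := 2 * (D + 2 / (k * E)) / k in hB.
  have kE : 0 < k * E by rewrite mulr_gt0.
  have W0 : 0 <= 2 / (k * E) by rewrite divr_ge0 // ltW.
  have V0 : 0 <= V by apply: divr_ge0 (ltW k0); apply: mulr_ge0 => //; exact: addr_ge0.
  have N2 : V <= N ^+ 2 by rewrite expr2; nra.
  have kV : k * V = 2 * (D + 2 / (k * E)) by rewrite /V; field; rewrite !gt_eqF.
  have h1 : 2 / (k * E) <= X.
    have : k * V <= k * N ^+ 2 by rewrite ler_pM2l.
    lra.
  have : E * (k * (2 / (k * E))) <= E * (k * X) by rewrite !ler_pM2l.
  have -> : E * (k * (2 / (k * E))) = 2 by field; rewrite !gt_eqF.
  lra.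
have dA := sl_detE A.
split; apply/cvgrPdist_lt => e ep; near=> i.
  have hk : 1 / (A 1 0 ^+ 2 * den2 A (z i)) < e ^+ 2 by near: i; exact: key.
  rewrite Re_mob -(@ltr_pXn2r _ 2) ?nnegrE ?(ltW ep) // real_normK ?num_real //.
  apply: le_lt_trans hk; have := den2_gt0 A (z i).
  have : (A 1 0 * ReC (z i) + A 1 1) ^+ 2 <= den2 A (z i) by rewrite /den2 lerDl sqr_ge0.
  have -> : A 0 0 / A 1 0 - ((A 0 0 * ReC (z i) + A 0 1) * (A 1 0 * ReC (z i) + A 1 1) +
    A 0 0 * A 1 0 * ImC (z i) ^+ 2) / den2 A (z i) =
    (A 1 0 * ReC (z i) + A 1 1) / (A 1 0 * den2 A (z i)).
    have := den2_gt0 A (z i) => /gt_eqF/negbT; rewrite /den2.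
    move: (A 0 0) (A 0 1) (A 1 0) (A 1 1) (ReC _) (ImC _) c0 dA => a b c d x y c0 dA D0.
    have hh (u : R) : u = a * d - b * c ->
      a / c - ((a * x + b) * (c * x + d) + a * c * y ^+ 2) / ((c * x + d) ^+ 2 + (c * y) ^+ 2) =
      u * (c * x + d) / (c * ((c * x + d) ^+ 2 + (c * y) ^+ 2)).
      by move=> ->; field; rewrite D0 c0.
    by rewrite (hh 1 (esym dA)) mul1r.
  move=> hp hD; rewrite expr_div_n exprMn ler_pdivrMr ?(mulr_gt0 k0) ?exprn_gt0 //.
  rewrite [leRHS](_ : _ = den2 A (z i)) //.
  by have D1 := negbT (gt_eqF hD); field; rewrite D1 c0.
have hk : 1 / (A 1 0 ^+ 2 * den2 A (z i)) < e ^+ 2 by near: i; exact: key.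
rewrite Im_mob sub0r normrN -(@ltr_pXn2r _ 2) ?nnegrE ?(ltW ep) // real_normK ?num_real //.
apply: le_lt_trans hk; have := den2_gt0 A (z i).
have : (A 1 0 * ImC (z i)) ^+ 2 <= den2 A (z i) by rewrite /den2 lerDr sqr_ge0.
move=> hp hD; rewrite expr_div_n ler_pdivrMr ?exprn_gt0 //.
rewrite [leRHS](_ : _ = den2 A (z i) / A 1 0 ^+ 2); last first.
  by have D1 := negbT (gt_eqF hD); field; rewrite D1 c0.
by rewrite ler_pdivlMr // mulrC -exprMn.
Unshelve. all: by end_near.
Qed.

Lemma dilation_subproof t : expR (t / 2) * expR (- (t / 2)) - 0 * 0 = 1 :> R.
Proof. by rewrite expRN divff ?mulr0 ?subr0 // gt_eqF // expR_gt0. Qed.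
Definition dilation t : SL2 := sl2 (dilation_subproof t).

Lemma act_dilation t s : act (dilation t) (upward 0 s) = upward 0 (t + s).
Proof.
apply: coords_inj; rewrite act_upward_coords /coords !mxE /=.
have E : expR t = expR (t / 2) ^+ 2 by rewrite -expRM_natl -mulr_natl; congr expR; field.
have p0 := expR_gt0 (t / 2); have r0 := expR_gt0 s.
rewrite expRD E expRN !mul0r !mulr0 !add0r !mul0r.
by congr ((_, _), (_, _)); field; rewrite !gt_eqF.
Qed.

Lemma geod_upward_add (t s : R) : geod t (upward 0 s : T1H) = upward 0 (s + t).
Proof. by rewrite -[in LHS](addr0 s) -act_dilation geod_act geod_upward act_dilation. Qed.

End Distance.

(** * Geodesics, half-planes and axes as quadratic forms *)

Section Geodesics.
Variable R : realType.
Local Notation SL2 := (SL2 R).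
Local Notation HH := (HH R).
Local Notation T1H := (T1H R).
Local Notation e0 := (upward (0 : R) 0).

Definition sqmod (w : HH) : R := ReC w ^+ 2 + ImC w ^+ 2.

(** The real part of the preimage of w under C, up to a positive factor (see
    [half_plane_form_mob]); its sign tells on which side of the image of the
    imaginary axis w lies. *)
Definition half_plane_form (C : SL2) (w : HH) : R :=
  - (C 1 0 * C 1 1) * sqmod w + (C 0 0 * C 1 1 + C 0 1 * C 1 0) * ReC w - C 0 0 * C 0 1.

(** The numerator of the fixed-point equation of A, with z^2 and z replaced by
    |w|^2 and Re w: its zero set is the geodesic joining the real fixed points of
    A. *)
Definition axis_form (A : SL2) (w : HH) : R :=
  A 1 0 * sqmod w + (A 1 1 - A 0 0) * ReC w - A 0 1.

Lemma mob_sl_inv (C : SL2) w : mob C (mob (sl_inv C) w) = w.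
Proof. by rewrite -mobM sl_mulxV mob1. Qed.

Lemma half_plane_form_mob C z : half_plane_form C (mob C z) = ReC z / den2 C z.
Proof.
rewrite /half_plane_form /sqmod Re_mob Im_mob; have := den2_gt0 C z => /gt_eqF/negbT; rewrite /den2.
have := sl_detE C; move: (C 0 0) (C 0 1) (C 1 0) (C 1 1) (ReC z) (ImC z) => a b c d x y dC D0.
have h (e : R) : e = a * d - b * c ->
  - (c * d) * ((((a * x + b) * (c * x + d) + a * c * y ^+ 2) / ((c * x + d) ^+ 2 + (c * y) ^+ 2)) ^+ 2 +
  (e * y / ((c * x + d) ^+ 2 + (c * y) ^+ 2)) ^+ 2) +
  (a * d + b * c) * (((a * x + b) * (c * x + d) + a * c * y ^+ 2) / ((c * x + d) ^+ 2 + (c * y) ^+ 2)) -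
   a * b = e ^+ 2 * x / ((c * x + d) ^+ 2 + (c * y) ^+ 2).
  by move=> ->; field; exact: D0.
by have := h 1 (esym dC); rewrite expr1n !mul1r.
Qed.

Lemma axis_form_mob A z : axis_form A (mob A z) = axis_form A z / den2 A z.
Proof.
rewrite /axis_form /sqmod Re_mob Im_mob; have := den2_gt0 A z => /gt_eqF/negbT; rewrite /den2.
have := sl_detE A; move: (A 0 0) (A 0 1) (A 1 0) (A 1 1) (ReC z) (ImC z) => a b c d x y dC D0.
have h (e : R) : e = a * d - b * c ->
  c * ((((a * x + b) * (c * x + d) + a * c * y ^+ 2) / ((c * x + d) ^+ 2 + (c * y) ^+ 2)) ^+ 2 +
  (e * y / ((c * x + d) ^+ 2 + (c * y) ^+ 2)) ^+ 2) +
  (d - a) * (((a * x + b) * (c * x + d) + a * c * y ^+ 2) / ((c * x + d) ^+ 2 + (c * y) ^+ 2)) -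
   b = e * (c * (x ^+ 2 + y ^+ 2) + (d - a) * x - b) / ((c * x + d) ^+ 2 + (c * y) ^+ 2).
  by move=> ->; field; exact: D0.
by have := h 1 (esym dC); rewrite !mul1r.
Qed.

Lemma line_act_upward C : line (act C e0) = [set w | half_plane_form C w = 0].
Proof.
apply/seteqP; split=> [_ [t _ <-]|w /= h].
  by rewrite /= geod_act geod_upward foot_act half_plane_form_mob Re_upward mul0r.
have := h; rewrite -{1}(mob_sl_inv C w) half_plane_form_mob => /eqP.
have D0 := den2_gt0 C (mob (sl_inv C) w).
rewrite mulf_eq0 invr_eq0 (gt_eqF D0) orbF => /eqP x0.
exists (ln (ImC (mob (sl_inv C) w))) => //.
rewrite geod_act geod_upward foot_act -[RHS](mob_sl_inv C); congr mob.
by apply: HH_eq; rewrite ?Re_upward ?Im_upward ?x0 // lnK // posrE Im_gt0.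
Qed.

Lemma mob_frame C z : mob (frame (act C e0)) z = mob C z.
Proof.
have e : z = foot (upward (ReC z) (ln (ImC z))).
  by apply: HH_eq; rewrite ?Re_upward ?Im_upward // lnK // posrE Im_gt0.
by rewrite e -!foot_act; congr foot; apply: act_inj_frame; rewrite frameP.
Qed.

Lemma closed_half_planeE C : closed_half_plane (act C e0) = [set w | 0 <= half_plane_form C w].
Proof.
apply/seteqP; split=> [_ [z /= hz <-]|w /= h].
  by rewrite /= mob_frame half_plane_form_mob divr_ge0 // ltW // den2_gt0.
exists (mob (sl_inv C) w); last by rewrite mob_frame mob_sl_inv.
move: h; rewrite -{1}(mob_sl_inv C w) half_plane_form_mob /=.
by rewrite pmulr_lge0 // invr_gt0 den2_gt0.
Qed.

Lemma open_half_planeE C : open_half_plane (act C e0) = [set w | 0 < half_plane_form C w].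
Proof.
apply/seteqP; split=> [_ [z /= hz <-]|w /= h].
  by rewrite /= mob_frame half_plane_form_mob divr_gt0 // den2_gt0.
exists (mob (sl_inv C) w); last by rewrite mob_frame mob_sl_inv.
move: h; rewrite -{1}(mob_sl_inv C w) half_plane_form_mob /=.
by rewrite pmulr_lgt0 // invr_gt0 den2_gt0.
Qed.

(** In the frame of an invariant geodesic the matrix maps the imaginary axis to
    itself; it is then diagonal or antidiagonal, and the second case has trace 0,
    which hyperbolicity forbids. *)
Lemma invariant_line_form A (u : T1H) : hyperbolic A -> mob A @` line u = line u ->
  exists2 k : R, k != 0 & forall w, axis_form A w = k * half_plane_form (frame u) w.
Proof.
move=> hA inv; set B := frame u.
have uE : u = act B e0 by rewrite frameP.
pose D := sl_mul (sl_inv B) (sl_mul A B).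
have AB w : mob A (mob B w) = mob B (mob D w).
  have e : sl_mul B D = sl_mul A B := sl_mulKV _ _.
  by rewrite -(mobM A) -(mobM B) e.
have AE : slmx A = B *m D *m sl_inv B.
  rewrite /= !mulmxA mulmxV ?mul1mx ?unitmxE ?sl_det ?unitr1 //.
  by rewrite -mulmxA mulmxV ?mulmx1 // unitmxE sl_det unitr1.
have Dt t : D 0 0 * D 1 0 * expR t ^+ 2 + D 0 1 * D 1 1 = 0.
  have : line u (mob A (mob B (foot (upward 0 t)))).
    rewrite -inv; exists (mob B (foot (upward 0 t))) => //.
    by exists t => //; rewrite uE geod_act geod_upward.
  rewrite AB uE line_act_upward /= half_plane_form_mob => /eqP.
  rewrite mulf_eq0 invr_eq0 (gt_eqF (den2_gt0 _ _)) orbF Re_mob.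
  rewrite mulf_eq0 invr_eq0 (gt_eqF (den2_gt0 _ _)) orbF Re_upward Im_upward.
  by rewrite !mulr0 !add0r addrC => /eqP.
have trD : \tr A = D 0 0 + D 1 1.
  rewrite AE mxtrace_mulC mulmxA mulVmx ?unitmxE ?sl_det ?unitr1 // mul1mx.
  rewrite /mxtrace !big_ord_recl !big_ord0 !addr0.
  by congr (_ + D _ _); apply/val_inj.
have dD := sl_detE D.
move: hA; rewrite /hyperbolic trD => hA.
have h0 := Dt 0; have h1 := Dt 1; rewrite expR0 expr1n mulr1 in h0.
have E1 : 1 < expR 1 ^+ 2 :> R by rewrite exprn_egt1 // expR_gt1.
have ac : D 0 0 * D 1 0 = 0 by move: (D 0 0 * D 1 0) (D 0 1 * D 1 1) h0 h1 => p q; nra.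
have bd : D 0 1 * D 1 1 = 0 by move: h0; rewrite ac add0r.
have [c0 b0] : D 1 0 = 0 /\ D 0 1 = 0.
  move: (D 0 0) (D 0 1) (D 1 0) (D 1 1) ac bd dD hA => a b c d ac bd dD hA.
  have a0 : a != 0.
    apply/eqP => a0; move: dD; rewrite a0 mul0r sub0r => dD.
    have b0 : b != 0.
      by apply/eqP => b0; move: dD; rewrite b0 mul0r oppr0 => /esym/eqP; rewrite oner_eq0.
    have d0 : d = 0 by apply/eqP; move/eqP: bd; rewrite mulf_eq0 (negbTE b0).
    by move: hA; rewrite a0 d0 addr0 normr0; lra.
  have c0 : c = 0 by apply/eqP; move/eqP: ac; rewrite mulf_eq0 (negbTE a0).
  split=> //; apply/eqP; move/eqP: bd; rewrite mulf_eq0 => /orP[//|/eqP d0].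
  by move: dD; rewrite c0 d0 !mulr0 subr0 => /esym/eqP; rewrite oner_eq0.
exists (D 1 1 - D 0 0).
  apply/eqP => h; have {}h : D 1 1 = D 0 0 by lra.
  move: dD hA; rewrite h c0 b0 mulr0 subr0; move: (D 0 0) => a.
  rewrite -expr2 -[a ^+ 2](@real_normK R) ?num_real // -mulr2n normrMn => a1.
  have : `|a| = 1 by apply/eqP; rewrite -(@eqrXn2 _ 2) ?expr1n //; apply/eqP.
  by move=> ->; rewrite ltxx.
clear AB Dt; move: D AE trD dD hA h0 h1 ac bd c0 b0 => D AE trD dD hA h0 h1 ac bd c0 b0.
move=> w; have eA i j : A i j = (B *m D *m sl_inv B) i j by rewrite -AE.
rewrite /axis_form /half_plane_form !eA !mulmx2E sl_inv_entries !mxE /= c0 b0.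
by ring.
Qed.

(** Uniqueness of the axis is [invariant_line_form]: every invariant line is the
    zero set of the same form. *)
Lemma axisE A C k : hyperbolic A -> k != 0 ->
  (forall w, axis_form A w = k * half_plane_form C w) -> axis A = line (act C e0).
Proof.
move=> hA k0 hk; have hz w : (half_plane_form C w == 0) = (axis_form A w == 0).
  by rewrite hk mulf_eq0 (negbTE k0).
apply/seteqP; split=> w.
  move=> [u /= inv]; have [k' k'0 hk'] := invariant_line_form hA inv.
  rewrite -[u in line u]frameP !line_act_upward /= => h.
  by apply/eqP; rewrite hz hk' h mulr0.
move=> hw; exists (act C e0) => //=; rewrite line_act_upward.
have stable z : (axis_form A (mob A z) == 0) = (axis_form A z == 0).
  by rewrite axis_form_mob mulf_eq0 invr_eq0 (gt_eqF (den2_gt0 _ _)) orbF.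
apply/seteqP; split=> [_ [z /eqP + <-]|z /eqP]; rewrite /= hz => h.
  by apply/eqP; rewrite hz stable.
exists (mob (sl_inv A) z); last by rewrite mob_sl_inv.
by apply/eqP; rewrite hz -stable mob_sl_inv.
Qed.
End Geodesics.

(** * Words in inversions *)

Section Words.
Variables (R : realType) (c r : nat -> R).

(** The inversion in the circle with center c and radius r is z |-> c + r^2 /
    (conj z - c), that is, this real matrix of determinant -1 applied to conj z.
    Conjugation commutes with real matrices, so the product of an even number of
    inversions is the Moebius map of the product of the matrices. *)
Definition refl_mx n : 'M[R]_2 := \matrix_(i, j)
  if i == 0 then if j == 0 then c n / r n else (r n ^+ 2 - c n ^+ 2) / r n
  else if j == 0 then (r n)^-1 else - (c n / r n).

Definition word_mx (w : seq nat) : 'M[R]_2 := foldr (fun n A => refl_mx n *m A) 1%:M w.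

Definition reduced (w : seq nat) := sorted (fun i j => i != j) w.

Hypothesis r_gt0 : forall n, 0 < r n.

Lemma refl_mxK n : refl_mx n *m refl_mx n = 1%:M.
Proof.
have := r_gt0 n => r0.
apply/matrixP => i j; rewrite mulmx2E !mxE.
case: i => [[|[|//]] ?]; case: j => [[|[|//]] ?] /=;
field; by rewrite gt_eqF.
Qed.

Lemma det_refl_mx n : \det (refl_mx n) = -1.
Proof.
have := r_gt0 n => r0.
by rewrite det_mx2 !mxE /=; field; rewrite gt_eqF.
Qed.

Lemma word_mx_cat w w' : word_mx (w ++ w') = word_mx w *m word_mx w'.
Proof. by elim: w => [|n w IH] /=; rewrite ?mul1mx // IH mulmxA. Qed.

Lemma word_mx_rev w : word_mx (rev w) *m word_mx w = 1%:M.
Proof.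
elim: w => [|n w IH]; first by rewrite mulmx1.
rewrite rev_cons -cats1 word_mx_cat /= mulmx1 -mulmxA (mulmxA (refl_mx n)).
by rewrite refl_mxK mul1mx.
Qed.

Lemma det_word_mx w : \det (word_mx w) = (-1) ^+ size w.
Proof.
by elim: w => [|n w IH] /=; rewrite ?det1 // det_mulmx det_refl_mx IH exprS.
Qed.

Lemma reduce_word w : exists w', [/\ reduced w', odd (size w') = odd (size w)
  & word_mx w' = word_mx w].
Proof.
elim: w => [|n w [w' [rw pw mw]]]; first by exists [::].
case: w' rw pw mw => [|m w'] rw pw mw.
  by exists [:: n]; split => //=; rewrite -?pw //= -mw.
have [nm|nm] := eqVneq n m.
  exists w'; split; first exact: path_sorted rw.
    by rewrite /= -pw /= negbK.
  by rewrite /= -mw /= mulmxA nm refl_mxK mul1mx.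
exists [:: n, m & w']; split; rewrite /= -?pw //.
  by rewrite /reduced /= nm.
by rewrite -mw.
Qed.

(** A reversed word is an inverse, so the entries d and c of an even word can be
    read as the first column of the reversed one. *)
Lemma word_mx_rev_entries w : ~~ odd (size w) ->
  word_mx (rev w) 0 0 = word_mx w 1 1 /\ word_mx (rev w) 1 0 = - word_mx w 1 0.
Proof.
move=> ow; have dw : \det (word_mx w) = 1.
  by rewrite det_word_mx -signr_odd (negbTE ow).
have /(congr1 (fun A => A *m (\adj (word_mx w)))) := word_mx_rev w.
rewrite -mulmxA mul_mx_adj dw mulmx1 mul1mx => ->.
rewrite !mxE /cofactor /= !det_mx11 !mxE /=; split.
  by rewrite expr0 mul1r; congr (word_mx w _ _); apply/val_inj.
by rewrite expr1 mulN1r; congr (- word_mx w _ _); apply/val_inj.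
Qed.
End Words.

(** * The sequence of circles *)

Section Circles.
Variable R : realType.

(** [scale n] is the smallest abscissa of the n-th circle for n > 0. It grows so
    fast that each circle is far beyond the preceding ones ([descent_gap]), while
    center / radius = (n + 1)^2 / (n (n + 2)) tends to 1 fast enough for the
    infinite product of these ratios to converge. *)
Fixpoint scale (n : nat) : R :=
  if n is k.+1 then 4 * (k%:R + 4) * (k%:R + 1) ^+ 2 * scale k else 1.
(** The 0-th circle is the unit circle. The others have their center on the
    positive axis and meet the real axis at [low n] and [up n]. *)
Definition ctr n : R := if n is 0%N then 0 else (n%:R + 1) ^+ 2 * scale n.
Definition crad n : R := if n is 0%N then 1 else n%:R * (n%:R + 2) * scale n.
Definition low n := ctr n - crad n.
Definition up n := ctr n + crad n.

Lemma ctr0 : ctr 0 = 0. Proof. by []. Qed.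
Lemma crad0 : crad 0 = 1. Proof. by []. Qed.

Lemma scale_gt0 n : 0 < scale n.
Proof.
elim: n => [|n IH] /=; first exact: ltr01.
have := ler0n R n => n0.
by rewrite !mulr_gt0 ?exprn_gt0 //; lra.
Qed.

Lemma crad_gt0 n : 0 < crad n.
Proof.
case: n => [|n]; first exact: ltr01.
by have := ler0n R n.+1; rewrite /crad => n0; rewrite !mulr_gt0 ?scale_gt0 ?ltr0n //; lra.
Qed.

Lemma crad_le_scale n : crad n <= (n%:R + 1) ^+ 2 * scale n.
Proof.
have := scale_gt0 n; have := ler0n R n; case: n => [|n] n0 s0; rewrite /crad.
  by rewrite add0r expr1n mul1r.
by rewrite ler_wpM2r ?(ltW s0) // expr2; lra.
Qed.

Lemma up_le_scale n : up n <= 2 * (n%:R + 1) ^+ 2 * scale n.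
Proof.
have := crad_le_scale n; have := scale_gt0 n; have := ler0n R n.
rewrite /up; case: n => [|n] n0 s0 h; first by rewrite /ctr /crad /=; lra.
by move: h; rewrite /ctr; lra.
Qed.

Lemma lowS n : low n.+1 = scale n.+1.
Proof. by rewrite /low /ctr /crad; ring. Qed.

Lemma low_le_ctr n : low n <= ctr n.
Proof. by rewrite /low; have := crad_gt0 n; lra. Qed.

Lemma up_gt0 n : 0 < up n.
Proof.
rewrite /up; have := crad_gt0 n; case: n => [|n]; rewrite /ctr; first lra.
by move=> h; rewrite addr_gt0 // mulr_gt0 ?scale_gt0 // exprn_gt0 // ltr_wpDl ?ler0n.
Qed.

Lemma opp_up_le_low n : - up n <= low n.
Proof.
suff : 0 <= ctr n by rewrite /up /low; lra.
by case: n => [|n]; rewrite ?ctr0 // mulr_ge0 ?sqr_ge0 ?ltW ?scale_gt0.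
Qed.

Lemma low_gt0 n : (0 < n)%N -> 0 < low n.
Proof. by case: n => // n _; rewrite lowS scale_gt0. Qed.

Lemma up8_le_lowS n : 8 * up n <= low n.+1.
Proof.
rewrite lowS /= -mulrA; have := up_le_scale n; rewrite -mulrA.
set E := (_ + 1) ^+ 2 * _ => h.
have E0 : 0 <= E by rewrite mulr_ge0 ?sqr_ge0 ?ltW ?scale_gt0.
by have := mulr_ge0 (ler0n R n) E0; lra.
Qed.

Lemma up8_le_low m n : (m < n)%N -> 8 * up m <= low n.
Proof.
elim: n => // n IH; rewrite ltnS leq_eqVlt => /orP[/eqP ->|/IH h].
  exact: up8_le_lowS.
have := up8_le_lowS n; have := up_gt0 n; have := crad_gt0 n; move: h.
by rewrite /up /low; lra.
Qed.

(** [escape_bound n] will bound the entry a from below after a descent starting at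
    the letter n, and [drift_bound n] = prod_(k >= n) ctr k / crad k from above
    along increasing words; the first tends to infinity, the second to 1. *)
Definition escape_bound (n : nat) : R := n%:R + 3.
Definition drift_bound (n : nat) : R := (n%:R + 1) / n%:R.

Lemma escape_step n : 4 * escape_bound n.+1 * crad n <= low n.+1.
Proof.
rewrite lowS /= /escape_bound -[in leRHS]mulrA; have := crad_le_scale n.
have := crad_gt0 n.
set E := (_ + 1) ^+ 2 * _ => h0 h; rewrite -natr1.
by have := ler0n R n => n0; nra.
Qed.

Lemma crad_homo : {homo crad : m n / (m <= n)%N >-> m <= n}.
Proof.
apply: homo_leq => [//|n m p h1 h2|n]; first exact: le_trans h1 h2.
have n0 := ler0n R n; apply: (@le_trans _ _ (low n.+1)).
  have := escape_step n; rewrite /escape_bound -natr1; have := crad_gt0 n => r0.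
  by have := mulr_ge0 n0 (ltW r0); lra.
rewrite lowS ler_peMl ?(ltW (scale_gt0 _)) // -natr1.
by have := mulr_ge0 n0 n0; lra.
Qed.

Lemma descent_gap m n : (m < n)%N -> 2 * escape_bound n * crad m <= low n - up m.
Proof.
move=> mn; have h1 := up8_le_low mn; case: n mn h1 => // n mn h1.
have := crad_homo (_ : m <= n)%N => /(_ mn) h2; have h3 := escape_step n.
have := up_gt0 m; have : 0 < escape_bound n.+1 by rewrite /escape_bound; have := ler0n R n.+1; lra.
by move=> K0; nra.
Qed.

Lemma drift_bound_step n : (0 < n)%N -> ctr n / crad n * drift_bound n.+1 = drift_bound n.
Proof.
case: n => // n _; rewrite /ctr /crad /drift_bound -!natr1.
have := scale_gt0 n.+1 => s0; have := ler0n R n => n0.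
by field; rewrite !gt_eqF //=; lra.
Qed.

Lemma drift_bound_anti m n : (0 < m)%N -> (m <= n)%N -> drift_bound n <= drift_bound m.
Proof.
move=> m0 mn; rewrite /drift_bound !mulrDl !divff ?pnatr_eq0 -?lt0n ?(leq_trans m0) //.
by rewrite lerD2l !div1r lef_pV2 ?posrE ?ltr0n ?(leq_trans m0) // ler_nat.
Qed.

Lemma escape_bound_homo : {homo escape_bound : m n / (m <= n)%N >-> m <= n}.
Proof. by move=> m n mn; rewrite lerD2r ler_nat. Qed.
End Circles.

Arguments ctr : simpl never.
Arguments crad : simpl never.

(** * Growth of the first column along a word *)

Section Columns.
Variable R : realType.
Local Notation ctr := (ctr R). Local Notation crad := (crad R).
Local Notation up := (up R). Local Notation low := (low R).
Local Notation W := (word_mx ctr crad).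

Lemma word_mx_cons n w :
  (W (n :: w) 0 0 = (ctr n * W w 0 0 - low n * up n * W w 1 0) / crad n) *
  (W (n :: w) 1 0 = (W w 0 0 - ctr n * W w 1 0) / crad n).
Proof.
have := crad_gt0 R n => r0.
split; rewrite /= mulmx2E !mxE /= /low /up; field; by rewrite gt_eqF.
Qed.

(** The point a / c of the real axis lies in the closed disc bounded by the n-th
    circle. *)
Definition in_cone n (a c : R) := c != 0 /\ `|a - ctr n * c| <= crad n * `|c|.

Lemma in_coneP n a c : in_cone n a c <->
  c != 0 /\ (low n <= a / c <= up n).
Proof.
rewrite /in_cone; split => -[c0 h]; split => //.
  have : `|a / c - ctr n| <= crad n.
    rewrite (_ : a / c - ctr n = (a - ctr n * c) / c); last by field.
    by rewrite normrM normfV ler_pdivrMr ?normr_gt0.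
  by rewrite ler_norml /low /up => /andP[h1 h2]; apply/andP; split; lra.
rewrite (_ : a - ctr n * c = (a / c - ctr n) * c); last by field.
rewrite normrM ler_wpM2r // ler_norml.
by move: h; rewrite /low /up => /andP[h1 h2]; apply/andP; split; lra.
Qed.

Lemma intervals_far_apart m n (x y : R) : (m < n)%N -> low m <= x <= up m ->
  low n <= y <= up n -> 8 * `|x| <= y.
Proof.
move=> mn /andP[h1 h2] /andP[h3 h4].
have := up8_le_low R mn => h5.
have := opp_up_le_low R m => h6.
have h : `|x| <= up m; last by lra.
by rewrite ler_norml h2 andbT; lra.
Qed.

Lemma in_cone_inj m n (a c : R) : in_cone m a c -> in_cone n a c -> m = n.
Proof.
wlog mn : m n / (m <= n)%N.
  by move=> h; case/orP: (leq_total m n) => mn h1 h2; [|apply/esym]; apply: h.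
move=> /in_coneP[c0 h1] /in_coneP[_ h2]; apply/eqP; rewrite eqn_leq mn /=.
rewrite leqNgt; apply/negP => lt_mn.
have h3 := intervals_far_apart lt_mn h1 h2.
have := up8_le_low R lt_mn; have := low_gt0 R (leq_ltn_trans (leq0n m) lt_mn).
by case/andP: h2; have := ler_norm (a / c); lra.
Qed.

(** The first column (a, c) of the matrix of a reduced word, by induction on the
    word. Let n be the first letter, m the second, (a', c') the column of the tail
    and x = a' / c', so that x lies in the m-th disc; then
      crad n * a = ctr n * a' - low n * up n * c' and crad n * c = a' - ctr n * c'.
    If m > n > 0, then x > up n, hence |a| lies between |a'| and (ctr n / crad n)
    |a'|: the entry a hardly moves. If m < n, then |x| is negligible compared with
    low n and the term low n * up n * c' dominates: a becomes large, and the later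
    increasing steps preserve that. The lower bound on |c| makes small c a sign of
    a large first letter. *)
Lemma word_growth n w (a := W (n :: w) 0 0) (c := W (n :: w) 1 0) :
  reduced (n :: w) ->
  [/\ in_cone n a c,
      1 <= 2 * crad n * `|c|
    & (0 < n)%N -> 1 <= `|a| /\
        if sorted ltn (n :: w) then `|a| <= drift_bound R n else escape_bound R n <= `|a|].
Proof.
elim: w n @a @c => [|m w IH] n.
  have := crad_gt0 R n => r0; have r1 : crad n != 0 by rewrite gt_eqF.
  rewrite !word_mx_cons !mxE /= !mulr1 !mulr0 !subr0 mul1r => _; split.
  - split; first by rewrite invr_eq0.
    by rewrite subrr normr0 mulr_ge0 // ltW.
  - by rewrite ger0_norm ?invr_ge0 ?ltW // -mulrA divff //; lra.
  case: n r0 r1 => // n r0 r1 _.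
  have cr : 1 <= ctr n.+1 / crad n.+1.
    by rewrite ler_pdivlMr // mul1r; have := low_gt0 R (ltn0Sn n); rewrite /low; lra.
  rewrite ger0_norm; last by lra.
  split=> //; rewrite -(drift_bound_step R (ltn0Sn n)) ler_peMr //; first lra.
  by rewrite /drift_bound ler_pdivlMr ?ltr0n // mul1r lerDl.
rewrite /reduced /= => /andP[nm rw]; move: (IH m rw).
set a := W (m :: w) 0 0; set c := W (m :: w) 1 0 => -[cn Hc Ha].
have r0 := crad_gt0 R n; have rm := crad_gt0 R m.
have [c0 hx] := (in_coneP _ _ _).1 cn; move: hx; set x := a / c => hx.
have aE : a = x * c by rewrite /x divfK.
have k0 : 0 < `|c| by rewrite normr_gt0.
rewrite !(word_mx_cons n (m :: w)) -/a -/c aE.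
rewrite (_ : x * c - _ * c = (x - ctr n) * c); last by ring.
rewrite (_ : ctr n * (x * c) - _ = (ctr n * x - low n * up n) * c); last by ring.
have farx : crad n <= `|x - ctr n|.
  have [mn|nm'] := ltnP m n.
    have := up8_le_low R mn; have := up_gt0 R m; case/andP: hx => h1 h2.
    by rewrite ler_normr /low => h3 h4; apply/orP; right; lra.
  have {}nm : (n < m)%N by rewrite ltn_neqAle nm.
  have := up8_le_low R nm; have := up_gt0 R n; case/andP: hx => h1 h2.
  by rewrite ler_normr /up => h3 h4; apply/orP; left; lra.
have cge : `|c| <= `|(x - ctr n) * c / crad n|.
  by rewrite !normrM normfV (gtr0_norm r0) ler_pdivlMr // mulrC ler_wpM2r // ltW.
split.
- split; first by rewrite -normr_gt0; exact: lt_le_trans k0 cge.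
  rewrite (_ : _ / crad n - _ = crad n * c); last first.
    by rewrite /low /up; field; rewrite gt_eqF.
  by rewrite normrM (gtr0_norm r0) ler_wpM2l // ltW.
- have [mn|nm'] := ltnP m n.
    apply: le_trans Hc _; apply: ler_pM => //; first by rewrite mulr_ge0 // ltW.
    by rewrite ler_pM2l // (crad_homo R) // ltnW.
  have {}nm : (n < m)%N by rewrite ltn_neqAle nm.
  have [a1 _] := Ha (leq_ltn_trans (leq0n n) nm).
  rewrite !normrM normfV (gtr0_norm r0) -!mulrA (mulrC (crad n)) !mulrA mulfVK ?gt_eqF //.
  have x0 : 0 < x by have := low_gt0 R (leq_ltn_trans (leq0n n) nm); case/andP: hx; lra.
  move: a1; rewrite aE normrM (gtr0_norm x0) => a1; apply: le_trans a1 _.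
  rewrite ler_pM2r //.
  have := up8_le_low R nm; case/andP: hx => h1 h2; have := up_gt0 R n.
  have := ler_norm (x - ctr n); rewrite /up; lra.
move=> n0; have c1 := low_gt0 R n0.
have u1 := up_gt0 R n.
have lcr : low n = ctr n - crad n by [].
have ucr : up n = ctr n + crad n by [].
rewrite !normrM normfV (gtr0_norm r0).
have [mn|nm'] := ltnP m n.
  (* The term low n * up n * c dominates, since |x| <= up m is small. *)
  suff hK : escape_bound R n <= `|ctr n * x - low n * up n| * `|c| / crad n.
    split; last by rewrite /= ltnNge ltnW.
    by apply: le_trans hK; rewrite /escape_bound; have := ler0n R n; lra.
  have := descent_gap R mn; set K := escape_bound R n => dg.
  have K0 : 0 < K by rewrite /K /escape_bound; have := ler0n R n; lra.
  have xm : `|x| <= up m.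
    have := opp_up_le_low R m; case/andP: hx => h1 h2 h3.
    by rewrite ler_norml h2 andbT; lra.
  have h1 : crad n * (low n - up m) <= `|ctr n * x - low n * up n|.
    apply: (@le_trans _ _ (low n * up n - ctr n * `|x|)); last first.
      rewrite distrC; apply: le_trans (ler_norm _).
      by rewrite lerD2l lerN2 ler_pM2l ?ler_norm //; lra.
    have : ctr n * `|x| <= ctr n * up m by rewrite ler_wpM2l //; lra.
    have : 0 < low n - up m by have := mulr_gt0 K0 rm; lra.
    by move: dg => _; nra.
  rewrite ler_pdivlMr //.
  apply: le_trans (ler_wpM2r (ltW k0) h1).
  have : crad n * (2 * K * crad m) * `|c| <= crad n * (low n - up m) * `|c|.
    by apply/(ler_wpM2r (ltW k0))/(ler_wpM2l (ltW r0)).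
  apply: le_trans.
  have : K * crad n * 1 <= K * crad n * (2 * crad m * `|c|).
    by apply: ler_wpM2l => //; rewrite mulr_ge0 // ltW.
  by lra.
have {}nm : (n < m)%N by rewrite ltn_neqAle nm.
have m0 := leq_ltn_trans (leq0n n) nm.
have [a1 aK] := Ha m0.
have xbig : up n <= x.
  by have := up8_le_low R nm; case/andP: hx; lra.
have x0 : 0 < x by lra.
move: a1 aK; rewrite aE normrM (gtr0_norm x0).
have -> : `|ctr n * x - low n * up n| = ctr n * x - low n * up n.
  by rewrite ger0_norm //; nra.
have lb : x * `|c| <= (ctr n * x - low n * up n) * `|c| / crad n.
  rewrite ler_pdivlMr // mulrAC; apply: (ler_wpM2r (ltW k0)); nra.
have ub : (ctr n * x - low n * up n) * `|c| / crad n <= ctr n / crad n * (x * `|c|).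
  rewrite [leRHS](_ : _ = ctr n * x * `|c| / crad n); last by ring.
  have k1 : 0 <= (crad n)^-1 by rewrite invr_ge0 ltW.
  by apply/(ler_wpM2r k1)/(ler_wpM2r (ltW k0)); nra.
move=> a1 aK; split; first exact: le_trans a1 lb.
move: aK; rewrite /= nm /=; case: ifP => _ aK; last first.
  by apply: le_trans (le_trans aK lb); rewrite (escape_bound_homo R) // ltnW.
apply: le_trans ub _; rewrite -(drift_bound_step R n0).
have cr0 : 0 <= ctr n / crad n by rewrite divr_ge0 ?ltW //; lra.
by rewrite ler_wpM2l //; apply: le_trans aK _; exact: (drift_bound_anti R).
Qed.
End Columns.

(** * The group *)

Section Group.
Variable R : realType.
Local Notation ctr := (ctr R). Local Notation crad := (crad R).
Local Notation W := (word_mx ctr crad).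
Local Notation S := (refl_mx ctr crad).
Let r0 := crad_gt0 R.

Lemma flute_gen_subproof n : \det (S n.+1 *m S 0) == 1.
Proof. by rewrite det_mulmx !(det_refl_mx _ r0) mulrNN mulr1. Qed.
(** Letters are shifted by one: the generators are the products of the inversions
    in the circles 1, 2, ... with the inversion in the unit circle. *)
Definition flute_gen n : SL2 R := MkSL2 (flute_gen_subproof n).

Definition flute_group : set (SL2 R) := smallest (@subgroup R) (range flute_gen).

Lemma flute_group_subgroup : subgroup flute_group.
Proof.
split=> [G [[]] //|A B hA hB G GP|A hA G GP].
  by have [[_ h _] _] := GP; apply: h; [exact: hA|exact: hB].
by have [[_ _ h] _] := GP; apply: h; exact: hA.
Qed.

Lemma flute_group_gen n : flute_group (flute_gen n).
Proof. by move=> G [_]; apply; exists n. Qed.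

Lemma slmx_inj (A B : SL2 R) : slmx A = slmx B -> A = B.
Proof. exact: val_inj. Qed.

Lemma flute_group_word A : flute_group A ->
  exists w, [/\ reduced w, ~~ odd (size w) & slmx A = W w].
Proof.
suff h : flute_group `<=`
    [set A | exists2 w, ~~ odd (size w) & slmx A = W w].
  move=> /h[w ow Aw]; have [w' [rw pw ew]] := reduce_word ctr r0 w.
  by exists w'; rewrite pw ew.
apply: smallest_sub; last by move=> _ [n _ <-]; exists [:: n.+1; 0] => //=; rewrite mulmx1.
split; first by exists [::].
  move=> {}A B [w ow Aw] [w' ow' Bw]; exists (w ++ w').
    by rewrite size_cat oddD (negbTE ow) (negbTE ow').
  by rewrite /= Aw Bw word_mx_cat.
move=> {}A [w ow Aw]; exists (rev w); first by rewrite size_rev.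
rewrite /= Aw; have /(congr1 (mulmx^~ (invmx (W w)))) := word_mx_rev ctr r0 w.
rewrite mul1mx -mulmxA mulmxV ?mulmx1 // unitmxE -Aw sl_det; exact: unitr1.
Qed.

(** The unit inversion can be inserted twice between two letters i and j: s_i s_j
    is the product of s_i s_0 and s_0 s_j. *)
Lemma even_word_flute w : ~~ odd (size w) ->
  exists2 A, flute_group A & slmx A = W w.
Proof.
have [G1 GM GV] := flute_group_subgroup.
have h0 n : exists2 A, flute_group A & slmx A = S n *m S 0.
  case: n => [|n]; last by exists (flute_gen n) => //; exact: flute_group_gen.
  by exists (sl_one R) => //; rewrite (refl_mxK _ r0).
have h1 n : exists2 A, flute_group A & slmx A = S 0 *m S n.
  have [A GA eA] := h0 n; exists (sl_inv A); first exact: GV.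
  apply: (@can_inj _ _ (mulmx (slmx A)) (mulmx (invmx (slmx A)))).
    by move=> B; rewrite mulmxA mulVmx ?mul1mx // unitmxE sl_det unitr1.
  rewrite /= mulmxV ?unitmxE ?sl_det ?unitr1 // eA -mulmxA (mulmxA (S 0) (S 0)).
  by rewrite (refl_mxK _ r0) mul1mx (refl_mxK _ r0).
have [k] := ubnP (size w); elim: k w => // k IH [|n [|m w]] //= sk; rewrite ?negbK => ow.
  by exists (sl_one R).
have [||A GA eA] := IH w => //; first by lia.
have [B GB eB] := h0 n; have [C GC eC] := h1 m.
exists (sl_mul B (sl_mul C A)); first by do 2!apply: (GM) => //.
rewrite /= eB eC eA -!mulmxA (mulmxA (S 0) (S 0)) (refl_mxK _ r0) mul1mx.
by [].
Qed.

Lemma rev_cons_last n (w : seq nat) : exists w', rev (n :: w) = last n w :: w'.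
Proof.
case/lastP: w => [|w m]; first by exists [::].
by rewrite -rcons_cons rev_rcons last_rcons; exists (rev (n :: w)).
Qed.

Lemma reduced_rev w : reduced (rev w) = reduced w.
Proof. by rewrite /reduced rev_sorted; apply: eq_sorted => i j /=; rewrite eq_sym. Qed.

(** [word_growth] applied to a word and to its reverse, which governs d. An
    increasing word ends with a letter larger than the first one, hence the third
    item; a word of length at least two and its reverse are not both increasing,
    hence the last one. *)
Lemma word_ends n w (A : 'M[R]_2) : reduced (n :: w) -> odd (size w) -> A = W (n :: w) ->
  let m := last n w in
  [/\ in_cone n (A 0 0) (A 1 0) /\ in_cone m (A 1 1) (- A 1 0),
      1 <= 2 * crad n * `|A 1 0| /\ 1 <= 2 * crad m * `|A 1 0|,
      (0 < n)%N -> (m <= n)%N -> escape_bound R n <= `|A 0 0|,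
      (0 < n)%N -> 1 <= `|A 0 0| /\ (escape_bound R n <= `|A 0 0| \/ `|A 0 0| <= drift_bound R n)
   &  (0 < n)%N -> (0 < m)%N -> escape_bound R n <= `|A 0 0| \/ escape_bound R m <= `|A 1 1|].
Proof.
move=> rw ow -> m.
have ow' : ~~ odd (size (n :: w)) by rewrite /= negbK.
have [e0 e1] := word_mx_rev_entries ctr r0 ow'.
have := rw; rewrite -reduced_rev.
have [w' ew] := rev_cons_last n w; rewrite ew -/m => rw'.
move: e0 e1; rewrite ew -/m => <- e1.
have [cn hc ha] := word_growth R rw.
have [cm hc' ha'] := word_growth R rw'.
rewrite e1 normrN in hc'; rewrite e1 in cm.
have mw : m \in w by rewrite /m; case: (w) ow => //= *; rewrite mem_last.
have sn : sorted ltn (n :: w) -> (n < m)%N.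
  by move=> /(order_path_min ltn_trans)/allP/(_ _ mw).
have sm : sorted ltn (m :: w') -> (m < n)%N.
  rewrite -ew rev_sorted => /order_path_min; move/(_ _)/allP; apply => //.
  by move=> ? ? ? /= h1 h2; exact: ltn_trans h2 h1.
split=> //.
- move=> n0 mn; have [_] := ha n0; case: ifP => // /sn.
  by rewrite ltnNge mn.
- by move=> n0; have [h1 h2] := ha n0; split=> //; case: ifP h2; [right|left].
move=> n0 m0; have [_] := ha n0; case: ifP => [/sn nm _|_]; last by left.
have [_] := ha' m0; case: ifP => [/sm mn _|_]; last by right.
by have := ltn_trans nm mn; rewrite ltnn.
Qed.
End Group.

(** * The surface *)

Section Surface.
Variable R : realType.
Local Notation ctr := (ctr R). Local Notation crad := (crad R).
Local Notation W := (word_mx ctr crad).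
Local Notation S := (refl_mx ctr crad).
Let r0 := crad_gt0 R.

Lemma flute_group_cases A : flute_group A -> A = sl_one R \/
  exists n w, [/\ reduced (n :: w), odd (size w) & slmx A = W (n :: w)].
Proof.
move=> /flute_group_word[[|n w] [rw ow eA]]; first by left; exact: slmx_inj.
by right; exists n, w; rewrite -[odd _]negbK.
Qed.

(** Either an extreme letter of the word is 0, and then c is not small, or both
    extreme letters are positive, and then a or d is large. *)
Lemma flute_away_from_one A : flute_group A -> A <> sl_one R ->
  [\/ 2^-1 <= `|A 1 0|, 4 <= `|A 0 0| | 4 <= `|A 1 1|].
Proof.
move=> /flute_group_cases[//|[n [w [rw ow eA]]]] _.
have [_ [hn hm] _ _ hK] := word_ends rw ow eA.
have K4 k : (0 < k)%N -> 4 <= escape_bound R k.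
  by case: k => // k _; rewrite /escape_bound -natr1; have := ler0n R k; lra.
case: (posnP n) hn hK => [-> hn _|n0 hn hK];
  first by constructor 1; rewrite crad0 in hn; lra.
case: (posnP (last n w)) hm hK => [-> hm _|m0 hm hK];
  first by rewrite crad0 in hm; constructor 1; lra.
by case: (hK isT isT) => h; [constructor 2|constructor 3]; apply: le_trans h; exact: K4.
Qed.

Lemma flute_group_discrete A : flute_group A ->
  isolated [set slmx B | B in @flute_group R] (slmx A).
Proof.
move=> GA; split; first by apply/mem_set; exists A.
(* The translate by A of a neighbourhood of 1 that meets the group only at 1. *)
pose V : set 'M[R]_2 := [set M | [/\
  `|(invmx A *m M) 1 0| < 2^-1, `|(invmx A *m M) 0 0| < 4 & `|(invmx A *m M) 1 1| < 4]].
exists V.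
  have cont i j : (fun M : 'M[R]_2 => (invmx A *m M) i j) M @[M --> slmx A] -->
      (1%:M : 'M[R]_2) i j.
    have -> : (1%:M : 'M[R]_2) i j = (invmx A *m A) i j.
      by rewrite mulVmx // unitmxE sl_det unitr1.
    rewrite mulmx2E; under eq_fun do rewrite mulmx2E.
    have cM k l : (M : 'M[R]_2) k l @[M --> slmx A] --> slmx A k l.
      exact: coord_continuous.
    exact: (cvgD (cvgM (cvg_cst _) (cM _ _)) (cvgM (cvg_cst _) (cM _ _))).
  have small i j e : `|(1%:M : 'M[R]_2) i j| < e ->
      \forall M \near slmx A, `|(invmx A *m M) i j| < e.
    move=> he; have := cvgr_norm_lt _ (cont i j) => h; exact: h.
  near=> M; split; near: M; apply: small;
    by rewrite !mxE /= ?normr0 ?normr1 ?invr_gt0 ?ltr0n ?ltr1n.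
apply/seteqP; split=> [M [[hc ha hd] [B GB eB]]|_ ->]; last first.
  split; last by exists A.
  rewrite /V /= mulVmx ?unitmxE ?sl_det ?unitr1 // !mxE /= normr0 normr1.
  by rewrite invr_gt0 ltr0n ltr1n.
have [G1 GM GV] := flute_group_subgroup R.
have GC : flute_group (sl_mul (sl_inv A) B) by apply: (GM) => //; exact: GV.
have [e|/(flute_away_from_one GC)] := pselect (sl_mul (sl_inv A) B = sl_one R); last first.
  rewrite /= eB => -[].
  - by move=> /(lt_le_trans hc); rewrite ltxx.
  - by move=> /(lt_le_trans ha); rewrite ltxx.
  - by move=> /(lt_le_trans hd); rewrite ltxx.
have := congr1 (fun C : SL2 R => A *m C) e.
by rewrite /= mulmxA mulmxV ?unitmxE ?sl_det ?unitr1 // mul1mx mulmx1 -eB => ->.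
Unshelve. all: by end_near.
Qed.

(** If the last letter m is smaller than the first letter n, the word is not
    increasing, so |a| >= 4; moreover a / c and - d / c lie in the n-th and the
    m-th discs, which forces |d| <= |a| / 8. *)
Lemma trace_distinct_ends n w (A : 'M[R]_2) : reduced (n :: w) -> odd (size w) ->
  A = W (n :: w) -> last n w != n -> 2 <= `|\tr A|.
Proof.
wlog lt_mn : n w A / (last n w < n)%N.
  move=> h rw ow eA mn; have [lt_mn|] := ltnP (last n w) n; first exact: h eA mn.
  rewrite leq_eqVlt eq_sym (negbTE mn) /= => lt_nm.
  have [w' ew] := rev_cons_last n w.
  have ow' : ~~ odd (size (n :: w)) by rewrite /= negbK.
  have [e0 _] := word_mx_rev_entries ctr r0 ow'.
  have ow'' : ~~ odd (size (rev (n :: w))) by rewrite size_rev.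
  have [e1 _] := word_mx_rev_entries ctr r0 ow''; rewrite revK in e1.
  have -> : \tr A = \tr (W (rev (n :: w))).
    rewrite eA /mxtrace !big_ord_recl !big_ord0 !addr0.
    have -> : lift ord0 ord0 = 1 :> 'I_2 by exact: val_inj.
    by rewrite e0 e1 addrC.
  have lw : last (last n w) w' = n.
    have := congr1 rev ew; rewrite revK => /(congr1 (head 0%N)) /=.
    case/lastP: (w') => [|v k] e; first exact/esym.
    by rewrite last_rcons e rev_cons rev_rcons.
  apply: (h (last n w) w') => //.
  - by rewrite lw.
  - by rewrite -ew reduced_rev.
  - by have := congr1 size ew; rewrite size_rev /= => -[<-].
  - by rewrite ew.
  - by rewrite lw eq_sym.
move=> rw ow eA _; have [[cn cm] _ hK _ _] := word_ends rw ow eA.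
have n0 := leq_ltn_trans (leq0n _) lt_mn.
have {hK} := hK n0 (ltnW lt_mn).
have [/in_coneP[c0 hx] /in_coneP[_ hy]] := (cn, cm).
have := intervals_far_apart lt_mn hy hx.
have -> : \tr A = A 0 0 + A 1 1.
  rewrite /mxtrace !big_ord_recl !big_ord0 !addr0.
  by congr (_ + A _ _); apply/val_inj.
move=> h1 hK.
have K3 : 4 <= escape_bound R n.
  by case: (n) n0 => // k _; rewrite /escape_bound -natr1; have := ler0n R k; lra.
have h2 : 8 * `|A 1 1| <= `|A 0 0|.
  have k0 : 0 < `|A 1 0| by rewrite normr_gt0.
  have -> : `|A 1 1| = `|A 1 1 / - A 1 0| * `|A 1 0|.
    by rewrite normrM normfV normrN mulfVK ?gt_eqF.
  have -> : `|A 0 0| = `|A 0 0 / A 1 0| * `|A 1 0|.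
    by rewrite normrM normfV mulfVK ?gt_eqF.
  rewrite mulrA; apply: (ler_wpM2r (ltW k0)); apply: le_trans h1 (ler_norm _).
have := lerB_dist (A 0 0) (- A 1 1); rewrite opprK normrN; lra.
Qed.

(** Conjugation removes equal letters at both ends. *)
Lemma trace_word w : reduced w -> ~~ odd (size w) -> 2 <= `|\tr (W w)|.
Proof.
have [k] := ubnP (size w); elim: k w => // k IH [|n w] sk rw ow.
  by rewrite /= mxtrace1 ger0_norm // ler_nat.
have [e|ne] := eqVneq (last n w) n; last first.
  by apply: (@trace_distinct_ends n w) => //; rewrite -[odd _]negbK.
case/lastP: w e sk rw ow => [//|w m].
rewrite last_rcons => -> /=; rewrite size_rcons => sk.
rewrite /reduced /= rcons_path => /andP[rw _] ow.
rewrite -cats1 word_mx_cat /= mulmx1 mulmxA mxtrace_mulC mulmxA (refl_mxK _ r0) mul1mx.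
apply: IH; first by lia.
  by exact: path_sorted rw.
by move: ow; rewrite /= negbK.
Qed.

Lemma flute_group_no_elliptic (A : SL2 R) : flute_group A -> ~ elliptic A.
Proof.
move=> /flute_group_word[w [rw ow eA]]; rewrite /elliptic eA.
by have := trace_word rw ow; lra.
Qed.

Definition flute : surface R :=
  Surface (flute_group_subgroup R) flute_group_discrete flute_group_no_elliptic.
End Surface.

(** * The vertical ray *)

Section Dynamics.
Variable R : realType.
Local Notation ctr := (ctr R). Local Notation crad := (crad R).
Local Notation W := (word_mx ctr crad).
Local Notation e0 := (upward (0 : R) 0).
Local Notation F := (flute R).
Local Notation u0 := (proj_T1 F e0).

Lemma lift_T1_proj (S : surface R) (u : T1H R) :
  exists2 A, Gam S A & lift_T1 (proj_T1 S u) = act A u.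
Proof.
have /proj_T1P[A GA hA] : proj_T1 S u = proj_T1 S (lift_T1 (proj_T1 S u)).
  by rewrite lift_T1K.
by exists A.
Qed.

Lemma repr_surf (S : surface R) (z : HH R) :
  exists2 A, Gam S A & repr (\pi_(surf S) z) = mob A z.
Proof.
have /surf_piP[A GA hA] : \pi_(surf S) z = \pi_(surf S) (repr (\pi_(surf S) z)).
  by rewrite reprK.
by exists A.
Qed.

Lemma ray_upward (S : surface R) t :
  ray (proj_T1 S e0) t = \pi_(surf S) (foot (upward 0 t)).
Proof. by rewrite /ray geodesic_flow_upward T1_foot_proj. Qed.

Lemma flute_c_neq0 (A : SL2 R) : flute_group A -> A <> sl_one R -> A 1 0 != 0.
Proof.
move=> /flute_group_cases[//|[n [w [rw ow eA]]]] _.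
by have [[[c0 _] _] _ _ _ _] := word_ends rw ow eA.
Qed.

(** A small c forces both extreme letters to exceed N. *)
Lemma small_c_dichotomy (A : SL2 R) N : flute_group A -> A <> sl_one R -> (0 < N)%N ->
  (2 * crad N) ^+ 2 * A 1 0 ^+ 2 < 1 ->
  [/\ 1 <= `|A 0 0|, escape_bound R N <= `|A 0 0| \/ `|A 0 0| <= drift_bound R N
    & escape_bound R N <= `|A 0 0| \/ escape_bound R N <= `|A 1 1|].
Proof.
move=> /flute_group_cases[//|[n [w [rw ow eA]]]] _ N0 hc.
have [_ [hn hm] _ ha had] := word_ends rw ow eA.
have key k : 1 <= 2 * crad k * `|A 1 0| -> (N < k)%N.
  move=> h; rewrite ltnNge; apply/negP => kN.
  have h1 : 1 <= 2 * crad N * `|A 1 0|.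
    apply: le_trans h _; apply: ler_wpM2r => //.
    by rewrite ler_pM2l // (crad_homo R).
  have : 1 <= (2 * crad N * `|A 1 0|) ^+ 2 by rewrite exprn_ege1.
  by rewrite exprMn real_normK ?num_real // leNgt hc.
have Nn := key _ hn; have Nm := key _ hm.
have n0 := ltn_trans N0 Nn; have m0 := ltn_trans N0 Nm.
have [a1 a2] := ha n0; split=> //.
- case: a2 => h; [left|right].
    by apply: le_trans h; exact: (escape_bound_homo R (ltnW Nn)).
  by apply: le_trans h _; exact: drift_bound_anti (ltnW Nn).
- case: (had n0 m0) => h; [left|right]; apply: le_trans h; exact: (escape_bound_homo R (ltnW _)).
Qed.

(** Near the upward vector at height e^t the entry c is small and a^2 is near e^t.
    But for small c either a^2 is larger than e^t + 1, or a^2 is close to 1. *)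
Lemma geodesic_flow_not_in_closure t : t != 0 ->
  ~ closure (horocyclic_orbit u0) (geodesic_flow t u0).
Proof.
move=> t0; set E := expR t.
have E0 : 0 < E := expR_gt0 t.
have E1 : 0 < `|E - 1|.
  by rewrite normr_gt0 subr_eq0 -expR0 (inj_eq (@expR_inj R)).
set dl := `|E - 1| in E1.
have x0 : 0 <= E + 6 / dl by rewrite addr_ge0 ?divr_ge0 ?(ltW E0) ?(ltW E1).
(* N makes escape_bound N ^+ 2 >= E + 1 and drift_bound N ^+ 2 <= 1 + dl / 2. *)
have := archi_boundP x0; set N := Num.bound _ => hN.
have d6 : 0 < 6 / dl by rewrite divr_gt0.
have N0 : (0 < N)%N by rewrite -(ltr0n R); lra.
have Nr : 0 < N%:R :> R by rewrite ltr0n.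
have K2 : E + 1 <= escape_bound R N ^+ 2.
  by rewrite /escape_bound; have := ler0n R N; nra.
have P2 : drift_bound R N ^+ 2 <= 1 + dl / 2.
  have -> : drift_bound R N = 1 + N%:R^-1 by rewrite /drift_bound; field; rewrite gt_eqF.
  have v0 : 0 < N%:R^-1 :> R by rewrite invr_gt0.
  have v1 : N%:R^-1 <= 1 :> R by rewrite invf_le1 // ler1n.
  have : N%:R^-1 <= dl / 6.
    rewrite -[leRHS]invrK invf_div lef_pV2 ?posrE //; lra.
  nra.
have r0 := crad_gt0 R N.
apply: (@not_closure_horocyclic_orbit _ _ t ((2 * crad N) ^- 2) (Num.min 1 (dl / 2))).
- by rewrite invr_gt0 exprn_gt0 // mulr_gt0.
- by rewrite lt_min ltr01 divr_gt0.
move=> A GA hc; rewrite ge_min; have [->|A1] := pselect (A = sl_one R).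
  by rewrite mxE eqxx expr1n -/E -/dl; apply/orP; right; lra.
have hc' : (2 * crad N) ^+ 2 * A 1 0 ^+ 2 < 1.
  by rewrite -ltr_pdivlMl ?mulr1 // exprn_gt0 // mulr_gt0.
have [a1 a2 _] := small_c_dichotomy GA A1 N0 hc'.
apply/orP; have a2E : A 0 0 ^+ 2 = `|A 0 0| ^+ 2 by rewrite real_normK ?num_real.
case: a2 => ha; [left|right].
  rewrite distrC; apply: le_trans (ler_norm _).
  have : escape_bound R N ^+ 2 <= A 0 0 ^+ 2.
    by rewrite a2E ler_pXn2r ?nnegrE // /escape_bound; have := ler0n R N; lra.
  by rewrite -/E; lra.
have h1 : 1 <= A 0 0 ^+ 2 by rewrite a2E exprn_ege1.
have h2 : A 0 0 ^+ 2 <= drift_bound R N ^+ 2.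
  by rewrite a2E ler_pXn2r ?nnegrE // (le_trans _ ha).
have h3 : `|A 0 0 ^+ 2 - 1| <= dl / 2 by rewrite ger0_norm; lra.
have : dl <= `|E - A 0 0 ^+ 2| + `|A 0 0 ^+ 2 - 1|.
  by rewrite /dl; apply: le_trans (ler_normD _ _); rewrite addrA subrK.
by rewrite -/E; lra.
Qed.

(** A vector fixed by a nontrivial time of the flow gives an element of the group
    with c = 0, hence the identity. *)
Lemma not_periodic : ~ horocyclic_periodic u0.
Proof.
move=> [s s0]; rewrite horocyclic_flow_proj horo_upward => /proj_T1P[A GA hA].
have [_ _] := col_act_upward A s; rewrite hA (col_upward 0).2 => /esym/eqP.
rewrite sqrf_eq0 => /eqP c0.
have [A1|A1] := pselect (A = sl_one R); last first.
  by have := flute_c_neq0 GA A1; rewrite c0 eqxx.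
move: hA; rewrite A1 act1 => /(congr1 (fun v => (coords v).1.1)) /= /eqP.
by rewrite (negbTE s0).
Qed.

Lemma column_sqnorm_ge (A : SL2 R) : flute_group A ->
  (A 0 0 ^+ 2 + A 1 0 ^+ 2) >= 4^-1.
Proof.
move=> /flute_group_cases[->|[n [w [rw ow eA]]]].
  by rewrite !mxE /= expr0n expr1n /=; lra.
have [_ [hn _] _ ha _] := word_ends rw ow eA.
case: (posnP n) hn ha => [->|n0] hn ha.
  have : 2^-1 <= `|A 1 0| by move: hn; rewrite crad0; lra.
  have := sqr_ge0 (A 0 0); rewrite -[A 1 0 ^+ 2](@real_normK R) ?num_real //.
  move: `|A 1 0| => x; nra.
have [a1 _] := ha isT.
have := sqr_ge0 (A 1 0); rewrite -[A 0 0 ^+ 2](@real_normK R) ?num_real //.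
by move: `|A 0 0| a1 => x; nra.
Qed.

Lemma hdist_repr_mob (S : surface R) (A : SL2 R) (z w : HH R) : Gam S A ->
  exists2 B, Gam S B & hdist (repr (\pi_(surf S) z)) (mob A (repr (\pi_(surf S) w))) =
    hdist z (mob B w).
Proof.
have [G1 GM GV] := Gam_subgroup S => GA.
have [B GB ->] := repr_surf S z; have [C GC ->] := repr_surf S w.
exists (sl_mul (sl_inv B) (sl_mul A C)); first exact: (GM _ _ (GV _ GB) (GM _ _ GA GC)).
by rewrite -(hdist_mob B z) -(mobM B) -(mobM A) sl_mulKV.
Qed.

Lemma hdist_repr_mob_conj (S : surface R) (A : SL2 R) (z : HH R) :
  Gam S A -> ~ acts_trivially A ->
  exists B, [/\ Gam S B, B <> sl_one R &
    hdist (repr (\pi_(surf S) z)) (mob A (repr (\pi_(surf S) z))) = hdist z (mob B z)].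
Proof.
have [G1 GM GV] := Gam_subgroup S => GA At.
have [B GB ->] := repr_surf S z.
have e (v : HH R) : mob B (mob (sl_mul (sl_inv B) (sl_mul A B)) v) = mob A (mob B v).
  by rewrite -(mobM B) sl_mulKV mobM.
exists (sl_mul (sl_inv B) (sl_mul A B)); split.
- exact: (GM _ _ (GV _ GB) (GM _ _ GA GB)).
- move=> h; apply: At => v; move: (e (mob (sl_inv B) v)); rewrite h mob1 -(mobM B).
  by rewrite sl_mulxV mob1.
- by rewrite -(hdist_mob B z) e.
Qed.

Lemma quasi_minimizing_ray : quasi_minimizing u0.
Proof.
(* 8 = 2 * 4: the hyperbolic cosine is at least (a^2 + c^2) e^t / 2. *)
exists (ln 8); first by rewrite ln_ge0 // ler1n.
move=> t t0; rewrite !ray_upward /surf_dist.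
apply: lb_le_inf; first by exists (hdist (repr (\pi_(surf F) (foot e0)))
  (mob (sl_one R) (repr (\pi_(surf F) (foot (upward 0 t)))))); exists (sl_one R) => //;
  case: (Gam_subgroup F).
move=> _ [A GA <-]; have [B GB ->] := hdist_repr_mob (foot e0) (foot (upward 0 t)) GA.
have E0 := expR_gt0 t.
have -> : t - ln 8 = ln (expR t / 8).
  by rewrite ln_div ?posrE // expRK.
apply: hdist_ge_ln; first by rewrite divr_gt0.
rewrite cosh_dist_upward expR0 !divr1 !mul1r !mulr1.
have := column_sqnorm_ge GB.
have h1 : 0 <= B 0 1 ^+ 2 / expR t by rewrite divr_ge0 ?sqr_ge0 // ltW.
have h2 : 0 <= B 1 1 ^+ 2 / expR t by rewrite divr_ge0 ?sqr_ge0 // ltW.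
by move=> h; nra.
Qed.

(** By [cosh_dist_upward] the displacement at height h = e^t is controlled by a^2
    + d^2 + b^2 / h^2 + c^2 h^2. Unless c h is large, c is so small that a or d is
    large. *)
Lemma displacement_large (M : R) : 0 < M -> exists T : R, forall t, T <= t -> forall A : SL2 R,
  flute_group A -> A <> sl_one R ->
  M <= cosh_dist (foot (upward 0 t)) (mob A (foot (upward 0 t))).
Proof.
move=> M0; have x0 : 0 <= 2 * M + 1 by lra.
have := archi_boundP x0; set N := Num.bound _ => hN.
have N0 : (0 < N)%N by rewrite -(ltr0n R); lra.
set L := (2 * crad N) ^+ 2; have L0 : 0 < L by rewrite exprn_gt0 // mulr_gt0 ?crad_gt0.
(* For t beyond this bound, h^2 = e^(2 t) >= e^t >= 2 M L. *)
exists (2 * M * L) => t ht A GA A1.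
have LM : 0 < 2 * M * L by rewrite mulr_gt0 // mulr_gt0.
have Et : 2 * M * L <= expR t by have := expR_ge1Dx t; lra.
have E1 : 1 <= expR t by have := expR_ge1Dx t; lra.
have E0 : 0 < expR t by lra.
rewrite cosh_dist_upward mulfK ?gt_eqF // mulfK ?gt_eqF //.
have h1 : 0 <= A 0 1 ^+ 2 / (expR t * expR t) by rewrite divr_ge0 ?sqr_ge0 // mulr_ge0 // ltW.
have h2 : 0 <= A 1 0 ^+ 2 * (expR t * expR t) by rewrite mulr_ge0 ?sqr_ge0 // mulr_ge0 // ltW.
have ha := sqr_ge0 (A 0 0); have hd := sqr_ge0 (A 1 1).
have [hc|hc] := leP (2 * M) (A 1 0 ^+ 2 * (expR t * expR t)); first by lra.
have hc' : L * A 1 0 ^+ 2 < 1.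
  have : A 1 0 ^+ 2 * (2 * M * L) <= A 1 0 ^+ 2 * (expR t * expR t).
    by apply: ler_wpM2l; [exact: sqr_ge0|nra].
  move=> h; have : (2 * M) * (L * A 1 0 ^+ 2) < 2 * M * 1 by lra.
  by rewrite ltr_pM2l // mulr_gt0.
have [_ _ hK] := small_c_dichotomy GA A1 N0 hc'.
have K0 : 2 * M <= escape_bound R N ^+ 2 by rewrite /escape_bound; have := ler0n R N; nra.
have K1 : 0 <= escape_bound R N by rewrite /escape_bound; have := ler0n R N; lra.
have sq (x : R) : escape_bound R N <= `|x| -> escape_bound R N ^+ 2 <= x ^+ 2.
  by move=> h; rewrite -[x ^+ 2]real_normK ?num_real // ler_pXn2r ?nnegrE.
by case: hK => /sq h; lra.
Qed.

Lemma thinness_infinite : asymptotic_thinness u0 = +oo%E.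
Proof.
rewrite /asymptotic_thinness limf_einfE; apply/eq_infty => M.
have [T hT] := displacement_large (expR_gt0 M).
apply: (@le_trans _ _ (ereal_inf ((fun t => Defs.Inj (ray u0 t)) @` [set t | T <= t]))); last first.
  apply: ereal_sup_ubound; exists [set t | T <= t] => //.
  by exists T; split; [exact: num_real|move=> x /ltW].
apply: le_ereal_inf_tmp => _ [t /= tT <-]; rewrite ray_upward.
apply: le_ereal_inf_tmp => _ [A [GA At] <-]; rewrite lee_fin.
have [B [GB B1 ->]] := hdist_repr_mob_conj (foot (upward 0 t)) GA At.
by rewrite -[M]expRK; apply: hdist_ge_ln; [exact: expR_gt0|exact: hT].
Qed.

Lemma flute_gen_entries n : [/\ flute_gen R n 0 0 = - (low R n.+1 * up R n.+1) / crad n.+1,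
  flute_gen R n 0 1 = ctr n.+1 / crad n.+1, flute_gen R n 1 0 = - ctr n.+1 / crad n.+1
  & flute_gen R n 1 1 = (crad n.+1)^-1].
Proof.
have r0 := negbT (gt_eqF (crad_gt0 R n.+1)).
rewrite /= !mulmx2E !mxE /= /low /up ctr0 crad0 !divr1 !expr1n !expr0n /=.
split; field; exact: r0.
Qed.

(** The generators carry i into discs that leave every compact set. *)
Lemma limit_at_infinity : tends_to_boundary \oo (fun n => mob (flute_gen R n) (foot e0)) None.
Proof.
apply/cvgryPge => M; near=> n.
apply: le_trans (Re_le_normc _); apply: le_trans (ler_norm _).
rewrite Re_mob /den2 Re_upward Im_upward expR0.
have [-> -> -> ->] := flute_gen_entries n.
have r0 := crad_gt0 R n.+1; have r1 := negbT (gt_eqF r0).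
have l0 := low_gt0 R (ltn0Sn n).
have cl := low_le_ctr R n.+1; have cu : ctr n.+1 <= up R n.+1 by rewrite /up; lra.
have l1 : n%:R + 1 <= low R n.+1.
  elim: (n) => [|k IH]; first by rewrite lowS /=; lra.
  have := up8_le_lowS R k.+1; rewrite -natr1.
  have : low R k.+1 <= up R k.+1 by rewrite /low /up; have := crad_gt0 R k.+1; lra.
  by have := ler0n R k; lra.
have nM : 2 * M <= n%:R by near: n; exact: nbhs_infty_ger.
move: (ctr n.+1) (low R n.+1) (up R n.+1) (crad n.+1) r0 r1 l0 cl cu l1.
move=> c l u r r0 r1 l0 cl cu l1.
have c1 : 1 <= c by have := ler0n R n; lra.
rewrite [leRHS](_ : _ = c * (l * u + 1) / (c ^+ 2 + 1)); last first.
  by field; rewrite r1 andbT gt_eqF //; nra.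
rewrite ler_pdivlMr; last by nra.
have : l * c <= l * u by rewrite ler_pM2l.
nra.
Unshelve. all: by end_near.
Qed.

Lemma upward_to_infinity t : forward_endpoint (upward 0 t : T1H R) None.
Proof.
apply/cvgryPge => M; near=> s.
rewrite geod_upward_add /= expr0n /= add0r sqrtr_sqr ger0_norm ?expR_ge0 //.
have : M - t <= s by near: s; apply: nbhs_pinfty_ge; exact: num_real.
by have := expR_ge1Dx (t + s); lra.
Unshelve. all: by end_near.
Qed.

(** The endpoint of the upward vectors is the limit point at infinity. The set is
    defined through a representative, that is, an unknown translate of the vector,
    whence the second case. *)
Lemma Omega_upward t : Omega_h (proj_T1 F (upward 0 t)).
Proof.
have [A GA eA] := lift_T1_proj F (upward 0 t).
have [G1 GM GV] := flute_group_subgroup R.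
rewrite /Omega_h /= eA; have [->|A1] := pselect (A = sl_one R).
  rewrite act1; exists None; first exact: upward_to_infinity.
  exists (foot e0), (flute_gen R); split; first exact: flute_group_gen.
  exact: limit_at_infinity.
have c0 := flute_c_neq0 GA A1.
exists (Some (A 0 0 / A 1 0)).
  rewrite /forward_endpoint; under eq_fun do rewrite geod_act foot_act.
  by apply: tends_mob => //; exact: upward_to_infinity.
exists (foot e0), (fun n => sl_mul A (flute_gen R n)); split.
  by move=> n; exact: (GM _ _ GA (@flute_group_gen R n)).
under eq_fun do rewrite mobM.
by apply: tends_mob => //; exact: limit_at_infinity.
Qed.
End Dynamics.

(** * A limit horocycle outside the orbit *)

Section NonClosed.
Variable R : realType.
Local Notation ctr := (ctr R). Local Notation crad := (crad R).
Local Notation W := (word_mx ctr crad).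
Local Notation e0 := (upward (0 : R) 0).
Local Notation F := (flute R).
Local Notation u0 := (proj_T1 F e0).
Let r1 n : crad n != 0 := negbT (gt_eqF (crad_gt0 R n)).

(** The image of the vector (x, 1) under the inversions 1, 2, ..., m in turn. If x
    is the point coded by the infinite word 1 2 3 ..., this vector represents the
    point coded by the word m+1, m+2, .... *)
Fixpoint tail_vec (x : R) (m : nat) : R * R :=
  if m is k.+1 then
    let: v := tail_vec x k in
    ((ctr m * v.1 - low R m * up R m * v.2) / crad m, (v.1 - ctr m * v.2) / crad m)
  else (x, 1).

Lemma tail_vecS x m : tail_vec x m.+1 =
  ((ctr m.+1 * (tail_vec x m).1 - low R m.+1 * up R m.+1 * (tail_vec x m).2) / crad m.+1,
   ((tail_vec x m).1 - ctr m.+1 * (tail_vec x m).2) / crad m.+1).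
Proof. by []. Qed.

Lemma tail_vec_neq0 x m : tail_vec x m <> (0, 0).
Proof.
elim: m => [[_ /eqP]|m IH]; first by rewrite oner_eq0.
rewrite tail_vecS => -[h1 h2]; apply: IH.
move: h1 h2; have := r1 m.+1; rewrite /low /up.
case: (tail_vec x m) => a g /=; move: (ctr m.+1) (crad m.+1) => c r r0 h1 h2.
have {}h2 : a = c * g.
  by apply/eqP; rewrite -subr_eq0; move/eqP: h2; rewrite mulf_eq0 invr_eq0 (negbTE r0) orbF.
have g0 : g = 0.
  have /eqP : r * g = 0 by rewrite -[RHS]h1 h2; field; exact: r0.
  by rewrite mulf_eq0 (negbTE r0) => /eqP.
by rewrite h2 g0 mulr0.
Qed.

Lemma tail_vec_continuous m (x : R) :
  ((tail_vec z m).1 @[z --> x] --> (tail_vec x m).1) /\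
  ((tail_vec z m).2 @[z --> x] --> (tail_vec x m).2).
Proof.
elim: m => [|m [IH1 IH2]]; first by split; [exact: cvg_id|exact: cvg_cst].
split.
  exact: (cvgM (cvgB (cvgM (cvg_cst _) IH1) (cvgM (cvg_cst _) IH2)) (cvg_cst _)).
exact: (cvgM (cvgB IH1 (cvgM (cvg_cst _) IH2)) (cvg_cst _)).
Qed.

Lemma word_mx_behead n w (A := W (n :: w)) :
  (W w 0 0 = (ctr n * A 0 0 - low R n * up R n * A 1 0) / crad n) /\
  (W w 1 0 = (A 0 0 - ctr n * A 1 0) / crad n).
Proof.
rewrite /A !word_mx_cons /low /up; have := r1 n => h; split; field; exact: h.
Qed.

(** Nonnegative exactly when [tail_vec x m] represents a point of the closed disc
    m + 1. *)
Definition cone_defect m x :=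
  crad m.+1 * `|(tail_vec x m).2| - `|(tail_vec x m).1 - ctr m.+1 * (tail_vec x m).2|.

Lemma tail_vec_word m w (c := W (iota 1 m ++ w) 1 0) :
  c != 0 -> let v := tail_vec (W (iota 1 m ++ w) 0 0 / c) m in
  v.1 = W w 0 0 / c /\ v.2 = W w 1 0 / c.
Proof.
elim: m w @c => [|m IH] w c c0 /=; first by rewrite divff.
have e : iota 1 m.+1 ++ w = iota 1 m ++ m.+1 :: w.
  by rewrite -[in LHS](addn1 m) iotaD -catA /= add1n.
have [] := IH (m.+1 :: w); rewrite -e //.
rewrite -/c => -> ->; have [-> ->] := word_mx_behead m.+1 w.
by split; rewrite !mulrA -?mulrBl ?mulrA; ring.
Qed.

(** If a word carries infinity to the point coded by m+1, m+2, ..., its first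
    letter is m+1 because the discs are disjoint; stripping letters one after the
    other, one finds that infinity itself lies in a disc. *)
Lemma tail_not_orbit_of_infinity x (hx : forall m, 0 <= cone_defect m x) w m l :
  reduced w -> W w 0 0 = l * (tail_vec x m).1 -> W w 1 0 = l * (tail_vec x m).2 -> False.
Proof.
have g0 k : (tail_vec x k).2 != 0.
  apply/eqP => h; have := hx k; rewrite /cone_defect h normr0 !mulr0 subr0 sub0r oppr_ge0.
  rewrite normr_le0 => /eqP h1; apply: (@tail_vec_neq0 x k).
  by rewrite [LHS]surjective_pairing h h1.
elim: w m => [|n w IH] m rw h1 h2.
  move: h1 h2; rewrite !mxE /= => h1 /esym/eqP.
  rewrite mulf_eq0 (negbTE (g0 m)) orbF => /eqP l0.
  by move/eqP: h1; rewrite l0 mul0r oner_eq0.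
have [cn _ _] := word_growth R rw.
have cm : in_cone m.+1 (W (n :: w) 0 0) (W (n :: w) 1 0).
  split; first by case: cn.
  rewrite h1 h2 mulrCA -mulrBr !normrM mulrCA ler_wpM2l //.
  by have := hx m; rewrite /cone_defect subr_ge0.
have nm := in_cone_inj cn cm.
have [e1 e2] := word_mx_behead n w.
apply: (IH m.+1); first exact: path_sorted rw.
  by rewrite e1 h1 h2 tail_vecS nm /=; ring.
by rewrite e2 h1 h2 tail_vecS nm /=; ring.
Qed.

(** The even truncations of the infinite word 1 2 3 .... *)
Definition increasing_mx k := W (iota 1 k.*2.+2).
(** The base point and the diameter of the horocycle of the k-th truncation. *)
Definition increasing_pt k : R * R :=
  (increasing_mx k 0 0 / increasing_mx k 1 0, (increasing_mx k 1 0 ^+ 2)^-1).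

(** Both bounds on the diameter come from [word_growth]: along increasing words c
    is bounded below by 1 / (2 crad 1), and above because a is at most
    [drift_bound 1]. *)
Lemma increasing_pt_bounds k : [/\ increasing_mx k 1 0 != 0,
  low R 1 <= (increasing_pt k).1 <= up R 1 &
  (low R 1 / drift_bound R 1) ^+ 2 <= (increasing_pt k).2 <= (2 * crad 1) ^+ 2].
Proof.
rewrite /increasing_pt /increasing_mx; set w := iota 2 k.*2.+1.
rewrite -[iota 1 _]/(1%N :: w) [fst _]/= [snd _]/=.
have sw : sorted ltn (1%N :: w) by exact: (iota_ltn_sorted 1 k.*2.+2).
have rw : reduced (1%N :: w).
  by apply: sub_sorted sw => i j /=; rewrite ltn_neqAle => /andP[].
have [cn hc [//|a1]] := word_growth R rw; rewrite sw => aP.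
have [c0 hx] := (in_coneP _ _ _).1 cn; split=> //.
move: aP c0 hx hc a1.
move: (W (1%N :: w) 0 0) (W (1%N :: w) 1 0) => a c aP c0 /andP[h1 h2] hc a1.
have r0 := crad_gt0 R 1; have l0 := low_gt0 R (ltn0Sn 0).
have k0 : 0 < `|c| by rewrite normr_gt0.
have c2 : c ^+ 2 = `|c| ^+ 2 by rewrite real_normK ?num_real.
have ge : low R 1 * `|c| <= drift_bound R 1.
  apply: le_trans aP; rewrite -[a](divfK c0) normrM ler_pM2r //.
  by apply: le_trans (ler_norm _).
have P0 : 0 < drift_bound R 1 by rewrite /drift_bound divr1; lra.
rewrite c2 -exprVn; apply/andP; split.
  rewrite ler_pXn2r ?nnegrE ?invr_ge0 ?divr_ge0 ?(ltW l0) ?(ltW P0) //.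
  by rewrite ler_pdivrMr // ler_pdivlMl // mulrC.
rewrite ler_pXn2r ?nnegrE ?invr_ge0 ?mulr_ge0 ?(ltW r0) //.
by rewrite -[leLHS]mul1r ler_pdivrMr.
Qed.

Lemma increasing_pt_defect m k : (m < k.*2.+2)%N -> 0 <= cone_defect m (increasing_pt k).1.
Proof.
move=> mk; rewrite /increasing_pt /cone_defect.
have [c0 _ _] := increasing_pt_bounds k; move: c0; rewrite /increasing_mx.
have -> : iota 1 k.*2.+2 = iota 1 m ++ m.+1 :: iota m.+2 (k.*2.+1 - m).
  have -> : k.*2.+2 = (m + (k.*2.+1 - m).+1)%N by lia.
  by rewrite iotaD /= add1n; congr (_ ++ _ :: iota _ _); lia.
set w := _ :: _ => c0; have [-> ->] := tail_vec_word c0.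
have sw : sorted ltn w by exact: (iota_ltn_sorted m.+1 (k.*2.+1 - m).+1).
have rw : reduced w.
  by apply: sub_sorted sw => i j /=; rewrite ltn_neqAle => /andP[].
have [[_ cn] _ _] := word_growth R rw.
by rewrite mulrA -mulrBl !normrM mulrA -mulrBl mulr_ge0 // subr_ge0.
Qed.

Lemma top_subproof (x c : R) (c0 : c != 0) : (x * c) * 0 - (- c^-1) * c = 1.
Proof. by rewrite mulr0 mulNr opprK add0r mulVf. Qed.
(** The unit vector pointing downwards at the top of the horocycle with base point
    x and diameter 1 / c^2: a choice of one vector on each horocycle that depends
    continuously on the horocycle. *)
Definition top_vector x c (c0 : c != 0) : T1H R := act (sl2 (top_subproof x c0)) e0.

Lemma coords_top_vector x c (c0 : c != 0) :
  coords (top_vector x c0) = ((x, (c ^+ 2)^-1), (0, - (c ^+ 2)^-1)).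
Proof.
rewrite act_upward_coords !mxE /= expR0.
by congr ((_, _), (_, _)); field; exact: c0.
Qed.

Lemma act_upward_top_vector (A : SL2 R) (c0 : A 1 0 != 0) :
  act A (upward (- (A 1 1 / A 1 0)) 0) = top_vector (A 0 0 / A 1 0) c0.
Proof.
apply: coords_inj; rewrite coords_top_vector act_upward_coords expR0.
have := sl_detE A; move: (A 0 0) (A 0 1) (A 1 0) (A 1 1) c0 => a b c d c0 dA.
have -> : c * - (d / c) + d = 0 by field.
rewrite !mulr1 !mul1r !mulr0 !mul0r !add0r expr0n /= ?add0r.
by congr ((_, _), (_, _)); field; exact: c0.
Qed.

(** The horocycles of the truncations of 1 2 3 ... have base points in a compact
    interval and diameters in a compact interval of positive numbers, hence they
    accumulate on some horocycle. Its base point x is coded by the whole infinite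
    word: each condition on the tails of x is closed, and holds for all long
    truncations. By [tail_not_orbit_of_infinity], this horocycle does not belong
    to the orbit. *)
Lemma horocyclic_orbit_not_closed : ~ closed (horocyclic_orbit u0).
Proof.
move=> cl.
pose K : set (R * R) := `[low R 1, up R 1] `*`
  `[(low R 1 / drift_bound R 1) ^+ 2, (2 * crad 1) ^+ 2].
have cK : compact K by apply: compact_setX; exact: segment_compact.
have FK : (increasing_pt @ \oo) K.
  by exists 0%N => // k _; have [_ h1 h2] := increasing_pt_bounds k; split; rewrite /= in_itv.
have [[x y] [[_ /=]]] := cK (increasing_pt @ \oo) _ FK; rewrite in_itv /= => /andP[y1 _] clu.
have l0 := low_gt0 R (ltn0Sn 0).
have P0 : 0 < drift_bound R 1 by rewrite /drift_bound divr1; lra.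
have y0 : 0 < y by apply: lt_le_trans y1; rewrite exprn_gt0 // divr_gt0.
have hx m : 0 <= cone_defect m x.
  rewrite leNgt; apply/negP => neg.
  have oU : nbhs x [set z | cone_defect m z < 0].
    have [t1 t2] := tail_vec_continuous m x.
    have ct : cone_defect m z @[z --> x] --> cone_defect m x.
      exact: (cvgB (cvgM (cvg_cst _) (cvg_norm t2)) (cvg_norm (cvgB t1 (cvgM (cvg_cst _) t2)))).
    exact: (cvgr_lt _ ct _ neg).
  have oU2 : nbhs (x, y) [set p : R * R | cone_defect m p.1 < 0].
    by have h1 : p.1 @[p --> (x, y)] --> x by [exact: cvg_fst]; exact: h1 oU.
  have [|p [[k mk <-] /= h]] := clu (increasing_pt @` [set k | (m <= k)%N]) _ _ oU2.
    by exists m => // k mk; exists k.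
  have /increasing_pt_defect : (m < k.*2.+2)%N by move: mk => /=; rewrite -addnn; lia.
  by rewrite leNgt h.
have s0 : (Num.sqrt y)^-1 != 0 by rewrite invr_eq0 sqrtr_eq0 -ltNge.
have sy : ((Num.sqrt y)^-1 ^+ 2)^-1 = y by rewrite exprVn invrK sqr_sqrtr // ltW.
pose v := top_vector x s0.
have vcl : closure (horocyclic_orbit u0) (proj_T1 F v).
  move=> V hV; have /= : nbhs v (proj_T1 F @^-1` V) by exact: (@pi_continuous _ _ v V hV).
  rewrite nbhsE => -[_ [ [Z oZ <-] /= Zv] sub].
  move: Zv; rewrite coords_top_vector sy => Zv.
  pose psi (p : R * R) : (R * R) * (R * R) := ((p.1, p.2), (0, - p.2)).
  have psic : psi p @[p --> (x, y)] --> psi (x, y).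
    have h1 : p.1 @[p --> (x, y)] --> x by exact: cvg_fst.
    have h2 : p.2 @[p --> (x, y)] --> y by exact: cvg_snd.
    have h3 : (- p.2) @[p --> (x, y)] --> - y by exact: cvgN h2.
    have h4 : ((0 : R), - p.2) @[p --> (x, y)] --> ((0 : R), - y).
      exact: (cvg_pair (cvg_cst _) h3).
    exact: (cvg_pair (cvg_pair h1 h2) h4).
  have On : nbhs (x, y) (psi @^-1` Z) by apply: psic; exact: open_nbhs_nbhs.
  have [|p [[k _ <-] /= hO]] := clu (range increasing_pt) _ _ On.
    by exists 0%N => // k _; exists k.
  have [c0 _ _] := increasing_pt_bounds k.
  have [|A GA eA] := @even_word_flute R (iota 1 k.*2.+2).
    by rewrite size_iota /= negbK odd_double.
  rewrite /increasing_pt /increasing_mx -eA in hO c0.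
  exists (proj_T1 F (top_vector (A 0 0 / A 1 0) c0)); split; last first.
    by apply: sub; rewrite /= coords_top_vector.
  apply/horocyclic_orbit_proj; exists (- (A 1 1 / A 1 0)).
  by apply/esym/proj_T1P; exists A => //; exact: act_upward_top_vector.
have /horocyclic_orbit_proj[s /esym/proj_T1P[A GA eA]] := cl _ vcl.
have [aa ac cc] := col_act_upward A s.
have [aa' ac' cc'] := col_act_upward (sl2 (top_subproof x s0)) 0.
move: aa ac cc aa' ac' cc'; rewrite eA !mxE /= => -> -> -> _ eac ecc.
have c0 : A 1 0 != 0 by rewrite -sqrf_eq0 ecc sqrf_eq0.
have ax : A 0 0 = A 1 0 * x.
  apply: (mulIf c0); rewrite eac.
  by transitivity (x * A 1 0 ^+ 2); [rewrite ecc|]; ring.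
have [A1|[n [w [rw ow eW]]]] := flute_group_cases GA.
  by move: c0; rewrite A1 mxE eqxx.
apply: (@tail_not_orbit_of_infinity x hx (n :: w) 0 (A 1 0)) => //=.
  by rewrite -[_ *m _]/(W (n :: w)) -eW.
by rewrite -[_ *m _]/(W (n :: w)) -eW mulr1.
Unshelve. all: by end_near.
Qed.
End NonClosed.

(** * The surface is an untwisted flute *)

Section FluteGeometry.
Variable R : realType.
Local Notation SL2 := (SL2 R).
Local Notation HH := (HH R).
Local Notation T1H := (T1H R).
Local Notation e0 := (upward (0 : R) 0).
Local Notation c n := (ctr R n.+1).
Local Notation r n := (crad R n.+1).
Local Notation l n := (low R n.+1).
Local Notation u n := (up R n.+1).

Lemma low_gt4 n : 4 < l n.
Proof.
have h : 8 * up R n <= l n := up8_le_lowS R n.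
suff : 1 <= up R n by lra.
elim: (n) => [|k IH]; first by rewrite /up ctr0 crad0 add0r.
have := up8_le_lowS R k; have : low R k.+1 <= up R k.+1; last by lra.
by rewrite /low /up; have := crad_gt0 R k.+1; lra.
Qed.

(** The common perpendicular to the unit circle and the circle n + 1 is the
    half-circle of center [axis_ctr n] orthogonal to the unit circle, |w|^2 + 1 =
    2 axis_ctr n Re w. *)
Definition axis_ctr n : R := (1 + l n * u n) / (2 * c n).

Lemma circle_facts n : [/\ 0 < r n, l n = c n - r n, u n = c n + r n & 4 < l n].
Proof. by split; [exact: crad_gt0|by []|by []|exact: low_gt4]. Qed.

Lemma axis_ctr_gt1 n : 1 < axis_ctr n.
Proof.
have [r0 eL eu l4] := circle_facts n.
rewrite /axis_ctr; move: (l n) (u n) (c n) (r n) r0 eL eu l4 => L U C r r0 eL eu l4.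
rewrite ltr_pdivlMr; nra.
Qed.

Lemma axis_ctr_lt m n : (m < n)%N -> axis_ctr m < axis_ctr n.
Proof.
move=> mn; have h := up8_le_low R (mn : (m.+1 < n.+1)%N).
have [r0 eL eu l4] := circle_facts m; have [r0' eL' eu' l4'] := circle_facts n.
rewrite /axis_ctr.
move: (l n) (u n) (c n) (r n) r0' eL' eu' l4' h => L' U' C' r' r0' eL' eu' l4' h.
move: (l m) (u m) (c m) (r m) r0 eL eu l4 h => L U C r r0 eL eu l4 h.
(* The center is at most low m + 1 for m, and at least half of low n for n. *)
apply: (@lt_trans _ _ (L + 1)).
  by rewrite ltr_pdivrMr; nra.
apply: (@lt_le_trans _ _ (L' / 2)); first by lra.
by rewrite ler_pdivlMr; nra.
Qed.

Lemma axis_ctr_inj : injective axis_ctr.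
Proof.
move=> m n e; case: (ltngtP m n) => // h; have := axis_ctr_lt h; rewrite e ltxx //.
Qed.

Lemma flute_gen_hyperbolic n : hyperbolic (flute_gen R n).
Proof.
rewrite /hyperbolic; have -> : \tr (flute_gen R n) = (1 - l n * u n) / r n.
  rewrite /mxtrace !big_ord_recl !big_ord0 !addr0.
  have -> : lift ord0 ord0 = 1 :> 'I_2 by exact: val_inj.
  by have [-> _ _ ->] := flute_gen_entries R n; ring.
have [r0 eL eu l4] := circle_facts n.
move: (l n) (u n) (c n) (r n) r0 eL eu l4 => L U C r r0 eL eu l4.
rewrite -normrN -mulNr opprB; apply: lt_le_trans (ler_norm _).
by rewrite ltr_pdivlMr //; nra.
Qed.

Lemma axis_form_gen n w : axis_form (flute_gen R n) w =
  c n / r n * (2 * axis_ctr n * ReC w - (sqmod w + 1)).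
Proof.
rewrite /axis_form; have [-> -> -> ->] := flute_gen_entries R n; rewrite /axis_ctr.
have [r0 eL eu l4] := circle_facts n.
move: (l n) (u n) (c n) (r n) r0 eL eu l4 => L U C r r0 eL eu l4.
by field; rewrite !gt_eqF //; lra.
Qed.

(** The unit circle is parametrized by t |-> (1 + i e^t) / (1 - i e^t), with real
    part (1 - e^(2 t)) / (1 + e^(2 t)); this is the time at which it meets the
    n-th axis, at the point of real part 1 / axis_ctr n. *)
Definition axis_time n : R := ln ((axis_ctr n - 1) / (axis_ctr n + 1)) / 2.

Lemma expR_axis_time n : expR (axis_time n) ^+ 2 = (axis_ctr n - 1) / (axis_ctr n + 1).
Proof.
have k1 := axis_ctr_gt1 n.
rewrite -expRM_natl /axis_time mulrC divfK ?pnatr_eq0 // lnK // posrE divr_gt0 //; lra.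
Qed.

Lemma axis_time_lt m n : (m < n)%N -> axis_time m < axis_time n.
Proof.
move=> /axis_ctr_lt h3; have h1 := axis_ctr_gt1 m; have h2 := axis_ctr_gt1 n.
rewrite /axis_time ltr_pM2r ?invr_gt0 // ltr_ln ?posrE ?divr_gt0 //; try lra.
by rewrite ltr_pdivrMr; [rewrite mulrAC ltr_pdivlMr; nra|lra].
Qed.

Lemma quarter_turn_subproof : (Num.sqrt 2)^-1 * (Num.sqrt 2)^-1 -
  (Num.sqrt 2)^-1 * - (Num.sqrt 2)^-1 = 1 :> R.
Proof.
rewrite mulrN opprK -expr2 exprVn sqr_sqrtr //; lra.
Qed.
(** It fixes i and carries the upward vector at i to the one tangent to the unit
    circle and pointing to -1. *)
Definition quarter_turn : SL2 := sl2 quarter_turn_subproof.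

(** Moving along the unit circle up to time t and then turning by a right angle,
    towards the side that puts the inside of the half-circle on the right. *)
Definition axis_mx t : SL2 := sl_mul (sl_mul quarter_turn (dilation t)) (sl_inv quarter_turn).

Lemma half_plane_form_axis n : exists2 k : R, 0 < k &
  forall w, half_plane_form (axis_mx (axis_time n)) w =
            k * (2 * axis_ctr n * ReC w - (sqmod w + 1)).
Proof.
have k1 := axis_ctr_gt1 n; have := expR_axis_time n.
set s : R := (Num.sqrt 2)^-1.
have s2 : s * s = 2^-1 by rewrite -expr2 exprVn sqr_sqrtr.
set p := expR (axis_time n / 2); have p0 : 0 < p := expR_gt0 _.
have -> : expR (axis_time n) = p ^+ 2 by rewrite -expRM_natl -mulr_natl; congr expR; field.
move=> E4; exists ((2 * p ^+ 2 * (axis_ctr n + 1))^-1).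
  by rewrite invr_gt0 !mulr_gt0 ?exprn_gt0 //; lra.
have en : [/\ axis_mx (axis_time n) 0 0 = (p + p^-1) / 2,
    axis_mx (axis_time n) 0 1 = (p^-1 - p) / 2,
    axis_mx (axis_time n) 1 0 = (p^-1 - p) / 2
  & axis_mx (axis_time n) 1 1 = (p + p^-1) / 2].
  rewrite /axis_mx !sl_mulE !sl_inv_entries !mxE /= expRN -/p -/s.
  split.
  - by transitivity ((s * s) * (p + p^-1)); [ring|rewrite s2; ring].
  - by transitivity ((s * s) * (p^-1 - p)); [ring|rewrite s2; ring].
  - by transitivity ((s * s) * (p^-1 - p)); [ring|rewrite s2; ring].
  - by transitivity ((s * s) * (p + p^-1)); [ring|rewrite s2; ring].
move=> w; rewrite /half_plane_form; have [-> -> -> ->] := en.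
have -> : axis_ctr n = (1 + p ^+ 4) / (1 - p ^+ 4).
  have -> : p ^+ 4 = (axis_ctr n - 1) / (axis_ctr n + 1) by rewrite -E4 -exprM.
  field; rewrite gt_eqF /=; [|lra].
  by rewrite subr_eq0; apply/eqP; lra.
have p4 : 1 - p ^+ 4 != 0.
  have -> : p ^+ 4 = (axis_ctr n - 1) / (axis_ctr n + 1) by rewrite -E4 -exprM.
  rewrite subr_eq0 eq_sym; apply/eqP => /(congr1 (fun x => x * (axis_ctr n + 1))).
  by rewrite divfK ?gt_eqF; lra.
field; rewrite p4 (_ : 1 + p ^+ 4 + (1 - p ^+ 4) = 2) ?pnatr_eq0 ?gt_eqF //.
by ring.
Qed.

Lemma axis_gen n : axis (flute_gen R n) = line (act (axis_mx (axis_time n)) e0).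
Proof.
have [k k0 hk] := half_plane_form_axis n.
have [r0 eL eu l4] := circle_facts n.
have cr0 : 0 < c n / r n by rewrite divr_gt0 //; lra.
have q0 : c n / r n / k != 0 by rewrite gt_eqF // divr_gt0.
apply: (axisE (flute_gen_hyperbolic n) q0) => w.
by rewrite axis_form_gen hk mulrA divfK // gt_eqF.
Qed.

Lemma mem_axis n w : axis (flute_gen R n) w -> sqmod w + 1 = 2 * axis_ctr n * ReC w.
Proof.
have [k k0 hk] := half_plane_form_axis n; rewrite axis_gen line_act_upward /= hk => /eqP.
by rewrite mulf_eq0 (gt_eqF k0) subr_eq0 => /eqP.
Qed.

Lemma mem_axis_Re_gt0 n w : axis (flute_gen R n) w -> 0 < ReC w.
Proof.
move=> /mem_axis h; have := axis_ctr_gt1 n; have : 0 <= sqmod w by rewrite addr_ge0 ?sqr_ge0.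
by move: h; move: (sqmod w) (ReC w) (axis_ctr n) => s x k; nra.
Qed.

Lemma nested_axes : nested (fun n => axis (flute_gen R n)).
Proof.
split.
  move=> m n _ _ [w [hm hn]]; apply: axis_ctr_inj.
  have x0 := mem_axis_Re_gt0 hm; move: (mem_axis hm); rewrite (mem_axis hn).
  by move=> h; nra.
move=> m n k /andP[mn nk]; exists (act (axis_mx (axis_time n)) e0).
have [q q0 hq] := half_plane_form_axis n.
split; first exact: axis_gen.
  rewrite open_half_planeE => w hw; rewrite /= hq mulr_gt0 // subr_gt0 (mem_axis hw).
  by rewrite ltr_pM2r ?(mem_axis_Re_gt0 hw) // ltr_pM2l // axis_ctr_lt.
rewrite closed_half_planeE => w hw; apply/negP; rewrite -ltNge hq.
rewrite pmulr_rlt0 // subr_lt0 (mem_axis hw).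
by rewrite ltr_pM2r ?(mem_axis_Re_gt0 hw) // ltr_pM2l // axis_ctr_lt.
Qed.

Lemma orthogonal_turn (B : SL2) :
  orthogonal_vec (act B e0) (act (sl_mul B (sl_inv quarter_turn)) e0).
Proof.
have cK : coords (act (sl_inv quarter_turn) e0) = ((0, 1), (1, 0)).
  rewrite act_upward_coords expR0 !sl_inv_entries !mxE /=.
  set s : R := (Num.sqrt 2)^-1.
  have s2 : s * s = 2^-1 by rewrite -expr2 exprVn sqr_sqrtr.
  rewrite !opprK !mulr0 !add0r !mulr1 !mul1r.
  have -> : s ^+ 2 + s ^+ 2 = 1 by rewrite expr2 s2; field.
  rewrite expr1n !divr1 invr1 subrr -(mulrA 2) s2 divff ?pnatr_eq0 //.
  by rewrite mulNr s2 addNr.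
have fK : foot (act (sl_inv quarter_turn) e0) = foot e0.
  apply: HH_eq; first exact: (congr1 (fun p => p.1.1) cK).
  by rewrite Im_upward expR0; exact: (congr1 (fun p => p.1.2) cK).
have vK : vec (act (sl_inv quarter_turn) e0) = 1.
  have h1 : ReC (vec (act (sl_inv quarter_turn) e0)) = 1 := congr1 (fun p => p.2.1) cK.
  have h2 : ImC (vec (act (sl_inv quarter_turn) e0)) = 0 := congr1 (fun p => p.2.2) cK.
  by move: h1 h2; case: (vec _) => a b /= -> ->.
rewrite actM; split; first by rewrite !foot_act -[in LHS]fK.
rewrite (vec_act B (act _ _)) (vec_act B e0) vK fK vec_upward expR0.
set d := mob_den B (foot e0) ^+ 2; case: (d^-1) => x y.
by simpc; rewrite /=; ring.
Qed.

Lemma geod_quarter_turn s t :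
  geod s (act quarter_turn (upward 0 t)) = act quarter_turn (upward 0 (t + s)).
Proof. by rewrite geod_act geod_upward_add. Qed.

Lemma untwisted_gen : untwisted (flute_gen R).
Proof.
exists (act quarter_turn (upward 0 (axis_time 0))) => n.
exists (act quarter_turn (upward 0 (axis_time n))), (axis_time n.+1 - axis_time n).
have orth k : orthogonal_vec (act quarter_turn (upward 0 (axis_time k)))
    (act (axis_mx (axis_time k)) e0).
  rewrite -[in upward 0 (axis_time k)](addr0 (axis_time k)) -act_dilation -actM.
  exact: orthogonal_turn.
split.
  split; first by rewrite subr_gt0 axis_time_lt // ltnSn.
    by exists (act (axis_mx (axis_time n)) e0) => //; exact: axis_gen.
  exists (act (axis_mx (axis_time n.+1)) e0); first exact: axis_gen.
  by rewrite geod_quarter_turn addrC subrK; exact: orth.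
move=> _ [s /= hs <-]; exists (axis_time n - axis_time 0 + s).
  rewrite /= in_itv /= andbT; move: hs; rewrite in_itv /= => /andP[s0 _].
  by rewrite addr_ge0 // subr_ge0; case: (n) => [|k]; rewrite // ltW // axis_time_lt.
by rewrite !geod_quarter_turn addrA [axis_time 0 + _]addrC subrK.
Qed.

Lemma disc_subproof (x q : R) (q0 : 0 < q) : (x + q) * (2 * q)^-1 - (x - q) / (2 * q) * 1 = 1.
Proof. by field; rewrite gt_eqF. Qed.
(** It carries the upward vector at i to a vector on the half-circle of center x
    and radius q that has the inside of this half-circle on its right; the entries
    avoid square roots. *)
Definition disc x q q0 : SL2 := sl2 (@disc_subproof x q q0).

Lemma half_plane_form_disc x q (q0 : 0 < q) w :
  half_plane_form (disc x q0) w = (q ^+ 2 - (ReC w - x) ^+ 2 - ImC w ^+ 2) / (2 * q).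
Proof. by rewrite /half_plane_form /sqmod !mxE /=; field; rewrite gt_eqF. Qed.

Lemma low_up_gt0 n : 0 < l n * u n.
Proof. by have [r0 eL eu l4] := circle_facts n; rewrite mulr_gt0 //; lra. Qed.

Lemma inverted_crad_gt0 n : 0 < r n / (l n * u n).
Proof. by rewrite divr_gt0 ?low_up_gt0 // crad_gt0. Qed.

(** The half-disc inside the circle n + 1 and its image under the inversion in the
    unit circle: the generator is the latter inversion followed by the inversion
    in the circle n + 1, hence it maps the outside of the second half-disc onto
    the inside of the first. *)
Definition schottky_vec n (b : bool) : T1H :=
  act (if b then disc (c n) (crad_gt0 R n.+1)
       else disc (c n / (l n * u n)) (inverted_crad_gt0 n)) e0.

(** Equation of the image of the circle n + 1 under the inversion in the unit
    circle. *)
Definition inner_form n (w : HH) : R := l n * u n * sqmod w - 2 * c n * ReC w + 1.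

Lemma schottky_false n w : closed_half_plane (schottky_vec n false) w <-> inner_form n w <= 0.
Proof.
rewrite /schottky_vec closed_half_planeE /= half_plane_form_disc /inner_form /sqmod.
have lu := low_up_gt0 n; have [r0 eL eu l4] := circle_facts n.
have eLU : l n * u n = c n ^+ 2 - r n ^+ 2 by rewrite eL eu; ring.
move: (l n * u n) (c n) (r n) (ReC w) (ImC w) lu r0 eLU; clear => L C q x y L0 q0 eL.
rewrite [X in 0 <= X](_ : _ = - (L * (x ^+ 2 + y ^+ 2) - 2 * C * x + 1) / (2 * q)); last first.
  have h : q ^+ 2 = C ^+ 2 - L by rewrite eL; ring.
  rewrite expr_div_n h; field; rewrite !gt_eqF //.
by rewrite pmulr_lge0 ?invr_gt0 ?mulr_gt0 // oppr_ge0.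
Qed.

Lemma schottky_map n w : open_half_plane (schottky_vec n true) (mob (flute_gen R n) w) <->
  0 < inner_form n w.
Proof.
rewrite /schottky_vec open_half_planeE /= half_plane_form_disc /inner_form /sqmod.
rewrite Re_mob Im_mob; have D0 := den2_gt0 (flute_gen R n) w; move: D0.
rewrite /den2; have [-> -> -> ->] := flute_gen_entries R n.
have [r0 eL eu l4] := circle_facts n.
have eLU : l n * u n = c n ^+ 2 - r n ^+ 2 by rewrite eL eu; ring.
rewrite eLU; move: (c n) (r n) (ReC w) (ImC w) r0; clear => C q x y q0 D0.
have D1 : 0 < (C * x - 1) ^+ 2 + (C * y) ^+ 2.
  have : 0 < q ^+ 2 * ((- C / q * x + q^-1) ^+ 2 + (- C / q * y) ^+ 2).
    by rewrite mulr_gt0 // exprn_gt0.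
  rewrite [X in _ < X](_ : _ = (C * x - 1) ^+ 2 + (C * y) ^+ 2) //.
  by field; rewrite gt_eqF.
rewrite [X in 0 < X <-> _](_ : _ = q / 2 / ((C * x - 1) ^+ 2 + (C * y) ^+ 2) *
   ((C ^+ 2 - q ^+ 2) * (x ^+ 2 + y ^+ 2) - 2 * C * x + 1)); last first.
  by field; rewrite (gt_eqF q0) (gt_eqF D1).
by rewrite pmulr_rgt0 // divr_gt0 // divr_gt0.
Qed.

Lemma schottky_true_Re n w : closed_half_plane (schottky_vec n true) w ->
  l n < ReC w < u n.
Proof.
rewrite /schottky_vec closed_half_planeE /= half_plane_form_disc => h.
have [r0 eL eu l4] := circle_facts n; have y0 := Im_gt0 w.
move: h; rewrite pmulr_lge0 ?invr_gt0 ?(mulr_gt0 (ltr0Sn R 1) r0) // eL eu.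
move: (c n) (r n) (ReC w) (ImC w) r0 y0; clear => C q x y q0 y0 h.
have y2 : 0 < y ^+ 2 by rewrite exprn_gt0.
have : `|x - C| < q.
  by rewrite -(@ltr_pXn2r _ 2) ?nnegrE ?(ltW q0) // real_normK ?num_real //; lra.
by rewrite ltr_norml => /andP[h1 h2]; apply/andP; split; lra.
Qed.

Lemma schottky_false_Re n w : closed_half_plane (schottky_vec n false) w ->
  [/\ 0 < ReC w, l n * ReC w < 1 & 1 < u n * ReC w].
Proof.
move=> /schottky_false; rewrite /inner_form /sqmod.
have [r0 eL eu l4] := circle_facts n; have := Im_gt0 w; have lu := low_up_gt0 n.
have -> : c n = (l n + u n) / 2 by rewrite eL eu; field.
have {eL eu} : l n < u n by lra.
move: (l n) (u n) (ReC w) (ImC w) l4 lu; clear => L U x y l4 lu LU y0 h.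
have p : (L * x - 1) * (U * x - 1) < 0.
  have : 0 < L * U * y ^+ 2 by rewrite mulr_gt0 // exprn_gt0.
  by lra.
have x0 : 0 < x by rewrite ltNge; apply/negP => x0; nra.
have LUx : L * x < U * x by rewrite ltr_pM2r.
split=> //; first by rewrite ltNge; apply/negP => h1; nra.
by rewrite ltNge; apply/negP => h1; nra.
Qed.

Lemma schottky_disjoint :
  trivIset setT (fun k : nat * bool => closed_half_plane (schottky_vec k.1 k.2)).
Proof.
have sep m n : (m < n)%N -> u m < l n.
  move=> mn; have := up8_le_low R (mn : (m.+1 < n.+1)%N); have := up_gt0 R m.+1; lra.
move=> [m a] [n b] _ _ [w /= [hm hn]].
have [_ _ _ lm] := circle_facts m; have [_ _ _ ln] := circle_facts n.
case: a b hm hn => [] [] hm hn.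
- have /andP[h1 h2] := schottky_true_Re hm; have /andP[h3 h4] := schottky_true_Re hn.
  by congr (_, _); case: (ltngtP m n) => // /sep h; exfalso; lra.
- have /andP[h1 h2] := schottky_true_Re hm; have [h3 h4 h5] := schottky_false_Re hn.
  by exfalso; nra.
- have [h1 h2 h3] := schottky_false_Re hm; have /andP[h4 h5] := schottky_true_Re hn.
  by exfalso; nra.
- have [h1 h2 h3] := schottky_false_Re hm; have [h4 h5 h6] := schottky_false_Re hn.
  by congr (_, _); case: (ltngtP m n) => // /sep h; exfalso; nra.
Qed.

Lemma flute_schottky : schottky_generators (flute R) (flute_gen R).
Proof.
split; [exact: flute_gen_hyperbolic|by []|exists schottky_vec; split].
  exact: schottky_disjoint.
move=> n; apply/seteqP; split=> [_ [w hw <-]|z hz].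
  by apply/schottky_map; rewrite ltNge; apply/negP => /schottky_false.
exists (mob (sl_inv (flute_gen R n)) z); last exact: mob_sl_inv.
move: hz; rewrite -{1}(mob_sl_inv (flute_gen R n) z) => /schottky_map.
by rewrite ltNge => /negP h /schottky_false.
Qed.

Lemma flute_untwisted : untwisted_flute (flute R).
Proof.
exists (flute_gen R); split; last exact: untwisted_gen.
by split; [exact: flute_schottky|exact: nested_axes].
Qed.
End FluteGeometry.

Theorem theorem1p2 (R : realType) :
  exists (F : surface R) (u : T1 F),
    [/\ untwisted_flute F, Omega_h u & infinite_quasi_minimizing u] /\
    [/\ ~ closed (horocyclic_orbit u) /\
        ~ (Omega_h (S := F) `<=` closure (horocyclic_orbit u)),
        asymptotic_thinness u = +oo%E
      & [set t : R | closure (horocyclic_orbit u) (geodesic_flow t u)] = [set 0]].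
Proof.
exists (flute R), (proj_T1 _ (upward 0 0)); split; split.
- exact: flute_untwisted.
- exact: Omega_upward.
- split; [exact: quasi_minimizing_ray|exact: Omega_upward|exact: not_periodic].
- split; first exact: horocyclic_orbit_not_closed.
  move=> dense; apply: (@geodesic_flow_not_in_closure R 1); first exact: oner_neq0.
  by apply: dense; rewrite geodesic_flow_upward; exact: Omega_upward.
- exact: thinness_infinite.
apply/seteqP; split=> [t /= ht|_ ->]; last first.
  apply: subset_closure; rewrite /= geodesic_flow_upward.
  by apply/horocyclic_orbit_proj; exists 0.
by apply/eqP; apply: contraPT ht; exact: geodesic_flow_not_in_closure.
Qed.
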